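(* Let $(G,\mathfrak{B})$ be a contracting self-similar group, let $\mathsf{X}$ be a basis of $\mathfrak{B}$, let $\mathcal{J}_G$ be its limit space, let $\mathfrak{G}$ be the groupoid of germs of the action of $G$ on the boundary $\mathsf{X}^\omega$ of the tree $\mathsf{X}^*$, and let $d\ge0$ be an integer. The following conditions are equivalent. (1) The topological (covering) dimension of $\mathcal{J}_G$ is less than or equal to $d$. (2) For every finite set $A\subset G$ there exist $n\ge1$ and a partition $V_0,V_1,\ldots,V_d$ of the $n$th level $\mathsf{X}^n$ of $\mathsf{X}^*$ such that for every $i$ the groupoid of isomorphisms between the subtrees $v\mathsf{X}^*$ of $\mathsf{X}^*$ generated by the maps $g:v\mathsf{X}^*\to g(v\mathsf{X}^* )$, for $g\in A$ and $v\in V_i$ such that $g(v)\in V_i$, is finite. (3) The condition in (2) holds for $A$ equal to the nucleus of $(G,\mathfrak{B})$ (with respect to $\mathsf{X}$). (4) The dynamical asymptotic dimension of $\mathfrak{G}$ is less than or equal to $d$.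
   Context: A self-similar group $(G,\mathfrak{B})$ is a group $G$ with a set $\mathfrak{B}$ (the biset) equipped with commuting left and right $G$-actions such that the right action is free and has finitely many orbits. A basis $\mathsf{X}\subset\mathfrak{B}$ is a set meeting every right orbit exactly once. For $g\in G$ and $x\in\mathsf{X}$ there are unique $g(x)\in\mathsf{X}$ and $g|_x\in G$ with $g\cdot x=g(x)\cdot g|_x$. This extends to an action of $G$ on the set $\mathsf{X}^*=\bigcup_{n\ge0}\mathsf{X}^n$ of finite words by $g(xv)=g(x)\,g|_x(v)$, with sections $g|_{v_1v_2}=(g|_{v_1})|_{v_2}$; $\mathsf{X}^*$ is a rooted tree with root the empty word, a word $v$ being adjacent to the words $vx$, $x\in\mathsf{X}$, and $G$ acts by tree automorphisms. $v\mathsf{X}^*$ is the subtree of words with prefix $v$; $g$ maps it to $g(v\mathsf{X}^* )=g(v)\mathsf{X}^*$ by $vw\mapsto g(v)g|_v(w)$. The action extends to the boundary $\mathsf{X}^\omega$ (right-infinite sequences, product topology). Parts of a partition may be empty. $(G,\mathfrak{B})$ is contracting if for some (equivalently, every) basis there is a finite set $\mathcal{N}\subset G$ such that for every $g\in G$ there is $n$ with $g|_v\in\mathcal{N}$ for all words $v$ of length at least $n$; the smallest such set $\mathcal{N}$ is the nucleus. Limit space: let $\mathsf{X}^{-\omega}$ be the space of left-infinite sequences $\ldots x_2x_1$ over $\mathsf{X}$ with the product topology. $\mathcal{J}_G$ is the quotient of $\mathsf{X}^{-\omega}$ by the equivalence relation identifying $\ldots x_2x_1$ with $\ldots y_2y_1$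 if there is a sequence $g_n$ of elements of the nucleus with $g_n(x_n\ldots x_2x_1)=y_n\ldots y_2y_1$ for all $n$. Groupoid of germs: the action groupoid $G\times\mathsf{X}^\omega$ has source $\mathsf{s}(g,x)=x$, range $\mathsf{r}(g,x)=g(x)$, product $(g_2,g_1(x))(g_1,x)=(g_2g_1,x)$ and the product topology ($G$ discrete). $\mathfrak{G}$ is its quotient by identifying $(g_1,x)$ with $(g_2,x)$ whenever $g_1$ and $g_2$ coincide as maps on a neighborhood of $x$, with the quotient topology. Its unit space $\mathfrak{G}^{(0)}$ is identified with $\mathsf{X}^\omega$. The dynamical asymptotic dimension of a topological groupoid $\mathfrak{G}$ is the smallest $d$ such that for every compact subset $C\subset\mathfrak{G}$ there exists an open cover $\{U_0,\ldots,U_d\}$ of $\mathfrak{G}^{(0)}$ such that for every $i$ the set $\{g\in C:\mathsf{s}(g),\mathsf{r}(g)\in U_i\}$ is contained in a compact subgroupoid of $\mathfrak{G}$. *)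

(* Defs.v *)
From HB Require Import structures.
From mathcomp Require Import all_boot all_classical topology.
From Stdlib Require Import Relation_Operators.

Set Implicit Arguments.
Unset Strict Implicit.
Unset Printing Implicit Defensive.

Local Open Scope classical_set_scope.
Local Open Scope group_scope.
Local Open Scope nat_scope.

Section TopologicalNotions.

Local Open Scope card_scope.

(* Lebesgue covering dimension at most d; the multiplicity bound d + 1 is
   monotone in d, and the empty space has dimension at most every d. *)
Definition covering_dim_le (T : topologicalType) (d : nat) : Prop :=
  forall U : set (set T),
    finite_set U -> U `<=` open -> \bigcup_(u in U) u = setT ->
  exists V : set (set T),
    [/\ finite_set V, V `<=` open, \bigcup_(v in V) v = setT,
        forall v, V v -> exists2 u, U u & v `<=` u
      & forall x, [set v | V v /\ v x] #<= `I_d.+1].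

(* The product [gmul] is total; it is meaningful on the pairs (a, b) with
   [gsrc a = grng b], for which it is a after b. *)
Record top_groupoid := TopGroupoid {
  gunit : topologicalType;
  garr : topologicalType;
  gsrc : garr -> gunit;
  grng : garr -> gunit;
  gid : gunit -> garr;
  ginv : garr -> garr;
  gmul : garr -> garr -> garr;
  _ : forall x, gsrc (gid x) = x;
  _ : forall x, grng (gid x) = x;
  _ : forall a, gsrc (ginv a) = grng a;
  _ : forall a, grng (ginv a) = gsrc a;
  _ : forall a b, gsrc a = grng b -> gsrc (gmul a b) = gsrc b;
  _ : forall a b, gsrc a = grng b -> grng (gmul a b) = grng a;
  _ : forall a b c, gsrc a = grng b -> gsrc b = grng c ->
        gmul a (gmul b c) = gmul (gmul a b) c;
  _ : forall a, gmul (gid (grng a)) a = a;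
  _ : forall a, gmul a (gid (gsrc a)) = a;
  _ : forall a, gmul (ginv a) a = gid (gsrc a);
  _ : forall a, gmul a (ginv a) = gid (grng a);
  _ : continuous gsrc;
  _ : continuous grng;
  _ : continuous gid;
  _ : continuous ginv;
  _ : {within [set p : garr * garr | gsrc p.1 = grng p.2],
        continuous (fun p : garr * garr => gmul p.1 p.2)}
}.

Definition subgroupoid (Γ : top_groupoid) (H : set (garr Γ)) : Prop :=
  (forall a, H a -> H (ginv a)) /\
  (forall a b, H a -> H b -> gsrc a = grng b -> H (gmul a b)).

(* Dynamical asymptotic dimension at most d: the condition is monotone in d,
   since the cover may be padded with empty sets.  No separation is assumed:
   [compact] is the open cover property. *)
Definition dyn_asdim_le (Γ : top_groupoid) (d : nat) : Prop :=
  forall C : set (garr Γ), compact C ->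
  exists U : 'I_d.+1 -> set (gunit Γ),
    [/\ forall i, open (U i), \bigcup_i U i = setT
      & forall i, exists H : set (garr Γ),
          [/\ subgroupoid H, compact H
            & [set a | C a /\ U i (gsrc a) /\ U i (grng a)] `<=` H]].

End TopologicalNotions.

(* A bijection between two subsets of T is encoded by its graph, so that its
   domain and range are [fst @` f] and [snd @` f].  The composition [f \; g]
   of the library applies g first.  The identities of a groupoid occur as
   [f^-1 \; f]. *)
Section GeneratedGroupoid.
Local Open Scope relation_scope.
Variable T : Type.

Definition bij_groupoid (H : set (set (T * T))) : Prop :=
  (forall f, H f -> H (f^-1)) /\
  (forall f g, H f -> H g -> fst @` f = snd @` g -> H (f \; g)).

Definition generated_groupoid (S : set (set (T * T))) : set (set (T * T)) :=
  smallest bij_groupoid S.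

End GeneratedGroupoid.

Record biset (G : groupType) := Biset {
  bcar :> choiceType;
  lact : G -> bcar -> bcar;
  ract : bcar -> G -> bcar;
  lact1 : forall b, lact 1%g b = b;
  lactM : forall g h b, lact (g * h)%g b = lact g (lact h b);
  ract1 : forall b, ract b 1%g = b;
  ractM : forall b g h, ract b (g * h)%g = ract (ract b g) h;
  lractC : forall g b h, lact g (ract b h) = ract (lact g b) h;
  ract_free : forall b g, ract b g = b -> g = 1%g;
  ract_fin : finite_set (range (fun b => range (ract b)))
}.

Record biset_basis (G : groupType) (B : biset G) := BisetBasis {
  bset :> set B;
  basisP : forall b : B, exists! x, bset x /\ range (ract b) x
}.

Section SelfSimilar.
Variables (G : groupType) (B : biset G) (X : biset_basis B).
Implicit Types (g h : G) (x : X) (v w : seq X).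

Fact basis_dec_subproof (b : B) : exists p : X * G, b = ract (val p.1) p.2.
Proof.
have [x [[Xx [g _ bgx]] _]] := basisP X b.
exists (SigSub (mem_set Xx) : X, g^-1%g) => /=.
by rewrite -bgx -ractM mulgV ract1.
Qed.

Definition basis_dec (b : B) : X * G := projT1 (cid (basis_dec_subproof b)).

Lemma basis_decP (b : B) : b = ract (val (basis_dec b).1) (basis_dec b).2.
Proof. exact: (projT2 (cid (basis_dec_subproof b))). Qed.

Lemma basis_decE x g : basis_dec (ract (val x) g) = (x, g).
Proof.
have := basis_decP (ract (val x) g); case: (basis_dec _) => y h /= exy.
have [z [_ zP]] := basisP X (val x).
have zx : z = val x.
  by apply: zP; split; [exact: set_valP | exists 1%g => //; exact: ract1].
have zy : z = val y.
  apply: zP; split; first exact: set_valP.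
  by exists (g * h^-1)%g => //; rewrite ractM exy -ractM mulgV ract1.
have yx : y = x by apply: val_inj; rewrite -zx -zy.
rewrite yx in exy *; congr (_, _).
have /ract_free e1 : ract (val x) (h * g^-1)%g = val x.
  by rewrite ractM -exy -ractM mulgV ract1.
by rewrite -[h]mulg1 -(mulVg g) mulgA e1 mul1g.
Qed.

(* g . x = g(x) . g|_x *)
Definition letter g x : X := (basis_dec (lact g (val x))).1.
Definition sect1 g x : G := (basis_dec (lact g (val x))).2.

Lemma letter_sectP g x :
  lact g (val x) = ract (val (letter g x)) (sect1 g x).
Proof. exact: basis_decP. Qed.

Fixpoint wact g w : seq X :=
  if w is x :: v then letter g x :: wact (sect1 g x) v else [::].

Definition sect g w : G := foldl sect1 g w.

(* X^omega and X^{-omega}: sequences indexed by nat; the point ... x2 x1 of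
   X^{-omega} is the function i |-> x_{i+1}. *)
Definition seqs : topologicalType :=
  prod_topology (fun _ : nat => discrete_topology X).

Definition oact g (z : seqs) : seqs :=
  fun n => letter (sect g (mkseq z n)) (z n).

(* the word x_n ... x2 x1 *)
Definition lword (z : seqs) (n : nat) : seq X := rev (mkseq z n).

Definition absorbing (N : set G) : Prop :=
  forall g, exists n, forall v, n <= size v -> N (sect g v).

Definition nucleus : set G :=
  smallest [set N | finite_set N /\ absorbing N] set0.

Definition asymp_equiv (y z : seqs) : Prop :=
  exists g : nat -> G,
    forall n, nucleus (g n) /\ wact (g n) (lword y n) = lword z n.

(* [asymp_equiv] is an equivalence relation when some finite set is absorbing,
   see [limit_relP]; passing to the generated equivalence relation makes the
   quotient available without this hypothesis. *)
Definition limit_rel : rel seqs :=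
  fun y z => `[< clos_refl_sym_trans seqs asymp_equiv y z >].

Fact limit_rel_refl : reflexive limit_rel.
Proof. by move=> y; apply/asboolP/rst_refl. Qed.

Fact limit_rel_sym : symmetric limit_rel.
Proof. by move=> y z; apply/asboolP/asboolP; exact: rst_sym. Qed.

Fact limit_rel_trans : transitive limit_rel.
Proof.
by move=> y x z /asboolP xy /asboolP yz; apply/asboolP; exact: rst_trans xy yz.
Qed.

Canonical limit_equiv :=
  EquivRel limit_rel limit_rel_refl limit_rel_sym limit_rel_trans.

Definition limit_space : topologicalType :=
  quotient_topology {eq_quot limit_equiv}%qT.

(* the graph of g : v X^* -> g(v) X^* *)
Definition subtree_map g v : set (seq X * seq X) :=
  [set (w, wact g w) | w in [set w | prefix v w]].

Definition tree_condition (d : nat) (A : set G) : Prop :=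
  exists n, exists V : 'I_d.+1 -> set (seq X),
    [/\ 1 <= n, \bigcup_i V i = [set w | size w = n], trivIset setT V
      & forall i, finite_set (generated_groupoid
          [set f | exists g v, [/\ A g, V i v, V i (wact g v)
                                 & f = subtree_map g v]])].

Lemma letter1 x : letter 1%g x = x.
Proof. by rewrite /letter lact1 -[val x]ract1 basis_decE. Qed.

Lemma sect11 x : sect1 1%g x = 1%g.
Proof. by rewrite /sect1 lact1 -[val x]ract1 basis_decE. Qed.

Lemma lactM_dec g h x : basis_dec (lact (g * h)%g (val x)) =
  (letter g (letter h x), (sect1 g (letter h x) * sect1 h x)%g).
Proof.
by rewrite lactM letter_sectP lractC letter_sectP -ractM basis_decE.
Qed.

Lemma letterM g h x : letter (g * h)%g x = letter g (letter h x).
Proof. by rewrite /letter lactM_dec. Qed.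

Lemma sect1M g h x : sect1 (g * h)%g x = (sect1 g (letter h x) * sect1 h x)%g.
Proof. by rewrite {1}/sect1 lactM_dec. Qed.

Lemma sect_w1 w : sect 1%g w = 1%g.
Proof. by elim: w => //= x w; rewrite sect11. Qed.

Lemma wact1 w : wact 1%g w = w.
Proof. by elim: w => //= x w IHw; rewrite letter1 sect11 IHw. Qed.

Lemma sectM g h w : sect (g * h)%g w = (sect g (wact h w) * sect h w)%g.
Proof. by elim: w g h => //= x w IHw g h; rewrite sect1M IHw. Qed.

Lemma wactM g h w : wact (g * h)%g w = wact g (wact h w).
Proof.
by elim: w g h => //= x w IHw g h; rewrite letterM sect1M IHw.
Qed.

Lemma sect_cat g v w : sect g (v ++ w) = sect (sect g v) w.
Proof. exact: foldl_cat. Qed.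

Lemma wact_cat g v w : wact g (v ++ w) = wact g v ++ wact (sect g v) w.
Proof. by elim: v g => //= x v IHv g; rewrite IHv. Qed.

Lemma size_wact g w : size (wact g w) = size w.
Proof. by elim: w g => //= x w IHw g; rewrite IHw. Qed.

Lemma mkseq_oact g (z : seqs) n : mkseq (oact g z) n = wact g (mkseq z n).
Proof.
by elim: n => // n IHn; rewrite !mkseqS -!cats1 wact_cat IHn.
Qed.

Lemma oact1 (z : seqs) : oact 1%g z = z.
Proof. by apply: funext => n; rewrite /oact sect_w1 letter1. Qed.

Lemma oactM g h (z : seqs) : oact (g * h)%g z = oact g (oact h z).
Proof.
by apply: funext => n; rewrite /oact sectM letterM -mkseq_oact.
Qed.

Lemma sectV g w : sect g^-1%g w = (sect g (wact g^-1%g w))^-1%g.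
Proof.
apply: (@mulgI _ (sect g (wact g^-1%g w))).
by rewrite -sectM mulgV sect_w1 mulgV.
Qed.

Section Nucleus.
Hypothesis contr : exists N : set G, finite_set N /\ absorbing N.

Lemma nucleus_finite : finite_set nucleus.
Proof.
have [N [finN absN]] := contr.
by apply: (sub_finite_set _ finN) => g; apply; split.
Qed.

Lemma nucleus_absorbing : absorbing nucleus.
Proof.
have [N [finN absN]] := contr; move=> g.
have [s sE] := (finite_seqP N).1 finN.
suff [n nP] : exists n, forall v, n <= size v ->
    N (sect g v) /\ (sect g v \in s -> nucleus (sect g v)).
  exists n => v /nP[Nv]; apply.
  by move: Nv; rewrite sE.
elim: {sE} s => [|h s [n nP]].
  by have [n nP] := absN g; exists n => v /nP.
have [Nh|] := pselect (nucleus h).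
  by exists n => v /nP[Nv vP]; split=> //; rewrite inE => /predU1P[->|/vP].
rewrite /nucleus /smallest => /existsNP[M /not_implyP[[[finM absM] _] nMh]].
have [m mP] := absM g; exists (maxn n m) => v.
rewrite geq_max => /andP[/nP[Nv vP] /mP Mv]; split=> //.
by rewrite inE => /predU1P[E|/vP//]; move: Mv; rewrite E.
Qed.

Lemma nucleus_absorbing_finite (A : set G) : finite_set A ->
  exists n, forall g v, A g -> n <= size v -> nucleus (sect g v).
Proof.
move=> /finite_seqP[s ->]; elim: s => [|h s [n nP]]; first by exists 0.
have [m mP] := nucleus_absorbing h; exists (maxn n m) => g v /=.
rewrite geq_max inE => /predU1P[->|gs] /andP[nv mv]; first exact: mP.
exact: nP.
Qed.

Lemma nucleusV g : nucleus g -> nucleus g^-1%g.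
Proof.
move=> Ng M [[finM absM] _].
have : [set h | M h^-1%g] g; last by [].
apply: Ng; split=> //; split.
  rewrite (_ : [set h | _] = (fun h => h^-1%g) @` M); first exact: finite_image.
  apply/seteqP; split=> [h Mh|_ [h Mh <-]] /=; last by rewrite invgK.
  by exists h^-1%g => //; rewrite invgK.
move=> h; have [n nP] := absM h^-1%g; exists n => v nv /=.
have := nP (wact h v); rewrite size_wact => /(_ nv).
by rewrite sectV -wactM mulVg wact1.
Qed.

Lemma nucleus1 (x : X) : nucleus 1%g.
Proof.
move=> M [[finM absM] _]; have [n nP] := absM 1%g.
by have := nP (nseq n x); rewrite size_nseq sect_w1; apply.
Qed.

Lemma lwordD (z : seqs) n k : exists2 u, size u = k &
  lword z (n + k) = u ++ lword z n.
Proof.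
exists (rev [seq z i | i <- iota n k]); first by rewrite size_rev size_map size_iota.
by rewrite /lword /mkseq iotaD map_cat rev_cat.
Qed.

Lemma limit_relP (y z : seqs) : limit_rel y z <-> asymp_equiv y z.
Proof.
split=> [/asboolP|yz]; last by apply/asboolP/rst_step.
elim=> {y z} // [y|y z _ [g gP]|x y z _ [g gP] _ [h hP]].
- exists (fun=> 1%g) => n; rewrite wact1; split=> //; apply: nucleus1 (y 0).
- exists (fun n => (g n)^-1%g) => n; have [Ng <-] := gP n.
  by split; [exact: nucleusV | rewrite -wactM mulVg wact1].
pose A := [set (a.1 * a.2)%g | a in nucleus `*` nucleus].
have finA : finite_set A.
  by apply: finite_image; apply: finite_setX; exact: nucleus_finite.
have [k kP] := nucleus_absorbing_finite finA.
pose u n := sval (cid2 (lwordD x n k)).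
exists (fun n => sect (h (n + k) * g (n + k))%g (u n)) => n.
have uS : size (u n) = k by rewrite /u; case: cid2.
have uE : lword x (n + k) = u n ++ lword x n by rewrite /u; case: cid2.
have [Ng gE] := gP (n + k); have [Nh hE] := hP (n + k); split.
  by apply: kP; [exists (h (n + k), g (n + k)) | rewrite uS].
have [t tS tE] := lwordD z n k.
have := hE; rewrite -gE -wactM uE tE wact_cat => /eqP.
by rewrite eqseq_cat ?size_wact ?uS ?tS // => /andP[_ /eqP].
Qed.

End Nucleus.

Lemma nbhs_prefix (z : seqs) n : \forall y \near z, mkseq y n = mkseq z n.
Proof.
elim: n => [|n IHn]; first exact: filterE.
have : \forall y \near z, y n = z n.
  have := @proj_continuous nat (fun=> discrete_topology X) n z.
  move=> /(_ [set z n]); apply.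
  by rewrite nbhs_principalE => ? ->.
by apply: filterS2 IHn => y /[!mkseqS] -> ->.
Qed.

Lemma oact_continuous g : continuous (oact g).
Proof.
move=> z; apply/cvg_sup => [|n U]; first exact/fmap_filter/(nbhs_filter z).
rewrite (@nbhsE (initial_topology (fun f : seqs => f n))) => -[_ [[C oC <-] Cz]].
move=> sCU; rewrite nbhs_simpl /=.
apply: filterS (nbhs_prefix z n.+1) => y; rewrite !mkseqS => /rcons_inj[yz yn].
by apply: sCU; move: Cz; rewrite /preimage /= /oact yz yn.
Qed.

(* the action groupoid, with (g, z) : z -> g(z) *)
Definition act_arr : topologicalType := (discrete_topology G * seqs)%type.

Implicit Types (p q : act_arr).

Definition germ_rel : rel act_arr := fun p q =>
  `[< p.2 = q.2 /\ \forall z \near p.2, oact p.1 z = oact q.1 z >].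

Fact germ_rel_refl : reflexive germ_rel.
Proof. by move=> p; apply/asboolP; split=> //; exact: filterE. Qed.

Fact germ_rel_sym : symmetric germ_rel.
Proof.
move=> p q; apply/asboolP/asboolP => -[pq pqP]; split=> //.
  by rewrite -pq; apply: filterS pqP.
by rewrite -pq; apply: filterS pqP.
Qed.

Fact germ_rel_trans : transitive germ_rel.
Proof.
move=> q p r /asboolP[pq pqP] /asboolP[qr qrP]; apply/asboolP.
split; first by rewrite pq.
by rewrite -pq in qrP; apply: filterS2 pqP qrP => z -> ->.
Qed.

Canonical germ_equiv :=
  EquivRel germ_rel germ_rel_refl germ_rel_sym germ_rel_trans.

Definition germ : topologicalType :=
  quotient_topology {eq_quot germ_equiv}%qT.

Definition germ_pi p : germ := (\pi_({eq_quot germ_equiv}%qT) p)%qT.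
Definition germ_repr (a : germ) : act_arr :=
  repr (a : {eq_quot germ_equiv}%qT).

Lemma germ_reprK a : germ_pi (germ_repr a) = a.
Proof. exact: reprK. Qed.

Lemma germ_piP p q : germ_pi p = germ_pi q <->
  p.2 = q.2 /\ \forall z \near p.2, oact p.1 z = oact q.1 z.
Proof.
split=> [/eqmodP/asboolP//|pq]; apply/eqmodP; exact/asboolP.
Qed.

Definition germ_src (a : germ) : seqs := (germ_repr a).2.
Definition germ_rng (a : germ) : seqs := oact (germ_repr a).1 (germ_repr a).2.
Definition germ_id (z : seqs) : germ := germ_pi (1%g, z).
Definition germ_inv (a : germ) : germ :=
  germ_pi ((germ_repr a).1^-1%g, germ_rng a).
Definition germ_mul (a b : germ) : germ :=
  germ_pi (((germ_repr a).1 * (germ_repr b).1)%g, germ_src b).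

Lemma germ_srcE p : germ_src (germ_pi p) = p.2.
Proof. by have /germ_piP[] := germ_reprK (germ_pi p). Qed.

Lemma germ_rngE p : germ_rng (germ_pi p) = oact p.1 p.2.
Proof.
have /germ_piP[E /nbhs_singleton] := germ_reprK (germ_pi p).
by rewrite /germ_rng => ->; rewrite E.
Qed.

Lemma germ_invE p : germ_inv (germ_pi p) = germ_pi (p.1^-1%g, oact p.1 p.2).
Proof.
apply/germ_piP; rewrite /= germ_rngE; split=> //.
have /germ_piP := germ_reprK (germ_pi p).
set q := germ_repr _ => -[qp near_q].
have cz : oact p.1^-1%g (oact p.1 p.2) = q.2 by rewrite -oactM mulVg oact1.
have near_q' : \forall z \near oact p.1 p.2,
    oact q.1 (oact p.1^-1%g z) = oact p.1 (oact p.1^-1%g z).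
  by move: near_q; rewrite -cz => /oact_continuous.
apply: filterS near_q' => z /= zP.
by rewrite -{1}[z]oact1 -(mulgV p.1) oactM -zP -oactM mulVg oact1.
Qed.

Lemma germ_mulE p q : p.2 = oact q.1 q.2 ->
  germ_mul (germ_pi p) (germ_pi q) = germ_pi ((p.1 * q.1)%g, q.2).
Proof.
move=> pq; apply/germ_piP; rewrite /= germ_srcE; split=> //.
have /germ_piP := germ_reprK (germ_pi p).
have /germ_piP := germ_reprK (germ_pi q).
move: (germ_repr _) (germ_repr _) => q' p' [qE near_q] [pE near_p].
rewrite qE in near_q; rewrite pE pq in near_p.
have := @oact_continuous q.1 q.2 _ near_p.
by apply: filterS2 near_q => z + /=; rewrite !oactM => ->.
Qed.

Lemma germ_pi_continuous : continuous germ_pi.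
Proof. exact: pi_continuous. Qed.

Lemma germ_nbhs p (W : set germ) : nbhs (germ_pi p) W ->
  \forall z \near p.2, W (germ_pi (p.1, z)).
Proof.
move=> /germ_pi_continuous[[P Q] [/= Pp Qp] PQW].
by apply: filterS Qp => z Qz; apply: (PQW (_, _)); split=> //; exact: nbhs_singleton.
Qed.

Lemma germ_nbhsP p (W : set germ) :
  (\forall z \near p.2, W (germ_pi (p.1, z))) -> nbhs (germ_pi p) W.
Proof.
rewrite nbhsE => -[U [oU Up] UW].
exists [set a | exists2 z, U z & a = germ_pi (p.1, z)]; last first.
  by move=> _ [z Uz ->]; exact: UW.
split; last by exists p.2 => //; case: (p).
rewrite /open /= /quotient_open openE => -[g z] /= [y Uy /germ_piP[/= zy gzP]].
rewrite zy in gzP *; exists ([set g], U `&` [set z | oact g z = oact p.1 z]°).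
  split=> /=; first by rewrite nbhs_principalE => ? ->.
  by apply: filterI (nbhs_interior gzP); apply: open_nbhs_nbhs.
by move=> [h x] [/= -> [Ux hx]]; exists x => //; apply/germ_piP.
Qed.

Lemma germ_src_continuous : continuous germ_src.
Proof.
move=> a W; rewrite -(germ_reprK a) germ_srcE => Wa.
by apply: germ_nbhsP; apply: filterS Wa => z; rewrite /= germ_srcE.
Qed.

Lemma germ_rng_continuous : continuous germ_rng.
Proof.
move=> a W; rewrite -(germ_reprK a) germ_rngE => /oact_continuous Wa.
have {}Wa : \forall z \near (germ_repr a).2, W (oact (germ_repr a).1 z) by [].
by apply: germ_nbhsP; apply: filterS Wa => z; rewrite /= germ_rngE.
Qed.

Lemma germ_id_continuous : continuous germ_id.
Proof. by move=> z W /germ_nbhs. Qed.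

Lemma germ_inv_continuous : continuous germ_inv.
Proof.
move=> a W; rewrite -(germ_reprK a) germ_invE => /germ_nbhs/oact_continuous Wa.
have {}Wa : \forall z \near (germ_repr a).2,
  W (germ_pi ((germ_repr a).1^-1%g, oact (germ_repr a).1 z)) by [].
by apply: germ_nbhsP; apply: filterS Wa => z; rewrite /= germ_invE.
Qed.

Lemma germ_mul_continuous :
  {within [set p : germ * germ | germ_src p.1 = germ_rng p.2],
    continuous (fun p : germ * germ => germ_mul p.1 p.2)}.
Proof.
apply/subspace_continuousP => -[a b] /=.
rewrite -(germ_reprK a) -(germ_reprK b) germ_srcE germ_rngE.
move: (germ_repr a) (germ_repr b) => p q pq W; rewrite /from_subspace /=.
rewrite germ_mulE // => /germ_nbhs /= Wpq.
rewrite /within /= nbhs_simpl /=.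
exists ([set germ_pi (p.1, z) | z in setT],
        [set germ_pi (q.1, z) | z in [set z | W (germ_pi ((p.1 * q.1)%g, z))]]).
  split; apply: germ_nbhsP; first by apply: filterE => z; exists z.
  by apply: filterS Wpq => z Wz; exists z.
move=> [_ _] [/= [y _ <-] [z Wz <-]]; rewrite germ_srcE germ_rngE /= => yz.
by rewrite germ_mulE.
Qed.

Definition germ_groupoid : top_groupoid.
Proof.
apply: (@TopGroupoid seqs germ germ_src germ_rng germ_id germ_inv germ_mul).
- by move=> z; rewrite germ_srcE.
- by move=> z; rewrite germ_rngE oact1.
- by move=> a; rewrite germ_srcE.
- by move=> a; rewrite -(germ_reprK a) germ_invE germ_rngE germ_srcE -oactM
    mulVg oact1.
- by move=> a b _; rewrite germ_srcE.
- move=> a b; rewrite -(germ_reprK a) -(germ_reprK b) germ_srcE germ_rngE => ab.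
  by rewrite germ_mulE // !germ_rngE oactM ab.
- move=> a b c; rewrite -(germ_reprK a) -(germ_reprK b) -(germ_reprK c).
  rewrite !germ_srcE !germ_rngE => ab bc.
  by rewrite !germ_mulE ?mulgA //= oactM -bc.
- move=> a; rewrite -(germ_reprK a) germ_rngE germ_mulE // mul1g.
  by case: germ_repr.
- move=> a; rewrite -(germ_reprK a) germ_srcE germ_mulE ?oact1 // mulg1.
  by case: germ_repr.
- by move=> a; rewrite -(germ_reprK a) germ_invE germ_srcE germ_mulE // mulVg.
- move=> a; rewrite -(germ_reprK a) germ_invE germ_rngE germ_mulE /= ?mulgV //.
  by rewrite -oactM mulVg oact1.
- exact: germ_src_continuous.
- exact: germ_rng_continuous.
- exact: germ_id_continuous.
- exact: germ_inv_continuous.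
- exact: germ_mul_continuous.
Defined.

End SelfSimilar.

Definition contracting (G : groupType) (B : biset G) : Prop :=
  exists (X : biset_basis B) (N : set G), finite_set N /\ absorbing X N.

(* Main.v *)
Require Import Defs.
From mathcomp Require Import all_boot all_classical topology.

Set Implicit Arguments.
Unset Strict Implicit.
Unset Printing Implicit Defensive.

Local Open Scope classical_set_scope.
Local Open Scope group_scope.
Local Open Scope nat_scope.

(** All conditions are compared on finite words. Two left-infinite sequences
    are identified in the limit space when, for every [n], an element of the
    nucleus moves the word of the last [n] letters of one to that of the other;
    so the words of length [n], joined when an element of the nucleus moves one
    to the other ([moves]), form a graph that approximates the limit space, the
    word [v] standing for the tile of all sequences that end with [v].
    Contraction says that a product of boundedly many moves becomes a single
    move after forgetting boundedly many letters on the left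
    ([moves_contract]), and compactness turns topological statements into
    statements about words of some fixed length ([asymp_nbhs],
    [saturated_cover]).

    From the tree, or from the germs, to the dimension. Both finiteness
    conditions imply that, for some colouring of a level [n], each component of
    one colour, in the graph of words of length [n + k], lies in one orbit of
    a finite set [F] that does not depend on [k] ([bounded_components]): for the
    tree, [F] represents the finitely many isomorphisms of the groupoid; for the
    germs, a compact subgroupoid is covered by the germs of finitely many
    elements of [G]. As [k] grows, the unions of tiles over these components
    become small, and the unions of one colour are disjoint closed sets.
    Thickening them gives open covers of arbitrarily small mesh and of
    multiplicity at most [d + 1] ([bounded_components_covering_dim]).

    From the dimension to the tree. The limit space is the quotient of a space
    on which [G] acts properly, so each point has a neighbourhood over which the
    product of the elements along a path of moves is confined to a finite set:
    it is known up to the finite isotropy group of the point ([exists_chart]).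
    Refine a finite cover by such charts to a cover of multiplicity at most
    [d + 1]. Consider, for a word [u] and lengths [t 0 < ... < t d.+1], the
    number of sets of the cover that contain the ball of the points agreeing
    with [u] up to a move on the last [t i] letters ([inside]); the ball shrinks
    as [i] grows. This number is nondecreasing in [i], at least 1 and at most
    [d + 1], hence it stagnates between some [i] and [i + 1], and one such [i] is
    the colour of [u] ([colour_exists]). Neighbours of the same colour then lie
    in the same sets of the cover, so a path in one colour stays inside one
    chart, and the groupoid of this colour is finite
    ([covering_dim_tree_condition]).

    From the tree to the germs, the germs of the finitely many isomorphisms in
    the groupoid of one colour form a compact subgroupoid
    ([tree_condition_dyn_asdim]). Finally, as the nucleus may be known to be
    finite for another basis only, contraction has to be transported from one
    basis to another ([absorbing_basis]). *)

(** * Finite sets of group elements and their sections *)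

Section Products.
Variable G : groupType.
Implicit Types (S : set G) (g h : G).

(** The products of [k] elements of [S]: balls for the word length when [S]
    contains 1. *)
Definition prods S k : set G :=
  iter k (fun P => [set (a * b)%g | a in S & b in P]) [set 1%g].

Lemma prods_finite S k : finite_set S -> finite_set (prods S k).
Proof.
by move=> finS; elim: k => [|k IHk]; [exact: finite_set1 | exact: finite_image2].
Qed.

Lemma prodsM S j k g h :
  prods S j g -> prods S k h -> prods S (j + k) (g * h)%g.
Proof.
elim: j g => [|j IHj] g /=; first by move=> -> Sh; rewrite mul1g.
move=> [a Sa [b Sb <-]] Sh; exists a => //; exists (b * h)%g; first exact: IHj.
by rewrite mulgA.
Qed.

Lemma prods_le S j k : S 1%g -> j <= k -> prods S j `<=` prods S k.
Proof.
move=> S1 /subnK <- g; elim: (k - j) => //= i IHi /IHi Sg.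
by exists 1%g => //; exists g; rewrite ?mul1g.
Qed.

Lemma prods1 S g : S g -> prods S 1 g.
Proof. by move=> Sg; exists g => //; exists 1%g; rewrite // mulg1. Qed.

End Products.

Section Sections.
Variables (G : groupType) (B : biset G) (X : biset_basis B).
Implicit Types (g h : G) (x : X) (u v w : seq X) (S : set G).

Definition sect_closed S := forall g v, S g -> S (sect g v).

Lemma prods_sect S k : sect_closed S -> sect_closed (prods S k).
Proof.
move=> scS; elim: k => [|k IHk] g v /=; first by move=> ->; rewrite sect_w1.
move=> [a Sa [b Sb <-]]; rewrite sectM.
by exists (sect a (wact b v)); [exact: scS | exists (sect b v) => //; exact: IHk].
Qed.

Lemma finite_basis : finite_set [set: X].
Proof.
have : finite_set ((fun x => range (ract (val x))) @^-1`
    range (fun b : B => range (ract b))).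
  apply: finite_preimage (ract_fin B) => x y _ _ /= xy; apply: val_inj.
  have [z [_ zP]] := basisP X (val x).
  have -> : val x = z.
    by apply/esym/zP; split; [exact: set_valP | exists 1%g; rewrite ?ract1].
  by apply: zP; split; [exact: set_valP | rewrite xy; exists 1%g; rewrite ?ract1].
by apply: sub_finite_set => x _; exists (val x).
Qed.

Lemma finite_words n : finite_set [set w : seq X | size w = n].
Proof.
elim: n => [|n IHn].
  by apply: sub_finite_set (finite_set1 [::]) => w /size0nil.
apply: sub_finite_set (finite_image2 cons finite_basis IHn) => -[//|x w] [wn].
by exists x => //; exists w.
Qed.

(** Only the finitely many short words can give sections outside of the
    absorbing set. *)
Lemma finite_sections (N A : set G) :
    finite_set N -> absorbing X N -> finite_set A ->
  finite_set [set h | exists g v, A g /\ h = sect g (v : seq X)].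
Proof.
move=> finN absN finA.
pose lv g := projT1 (cid (absN g)).
have lvP g v : lv g <= size v -> N (sect g v).
  by rewrite /lv; case: cid => n /=; apply.
have : finite_set (N `|` \bigcup_(g in A) \bigcup_(n in `I_(lv g))
    [set sect g v | v in [set w : seq X | size w = n]]).
  rewrite finite_setU; split=> //; apply: bigcup_finite => // g _.
  apply: bigcup_finite => [|n _]; first exact: finite_II.
  exact: finite_image (finite_words n).
apply: sub_finite_set => h [g [v [Ag ->]]].
have [/lvP|gv] := leqP (lv g) (size v); first by left.
by right; exists g => //; exists (size v) => //; exists v.
Qed.

Section Nucleus.
Hypothesis contr : exists N : set G, finite_set N /\ absorbing X N.

(** The elements of the nucleus all of whose sections lie in the nucleus still
    form an absorbing set, so minimality makes them the whole nucleus. *)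
Lemma nucleus_sect : sect_closed (nucleus X).
Proof.
suff sub : nucleus X `<=` [set g | forall v, nucleus X (sect g v)].
  by move=> g v /sub.
move=> g /(_ [set g | nucleus X g /\ forall v, nucleus X (sect g v)]).
case=> //; split=> //; split.
  by apply: sub_finite_set (nucleus_finite contr) => h [].
move=> {}g; have [n nP] := nucleus_absorbing contr g.
exists n => v nv; split=> [|w]; first exact: nP.
by rewrite -sect_cat; apply: nP; rewrite size_cat (leq_trans nv) ?leq_addr.
Qed.

End Nucleus.
End Sections.

(** * Independence of the basis *)

Section BasisChange.
Variables (G : groupType) (B : biset G) (X Y : biset_basis B).
Implicit Types (g h : G) (y : Y) (v w : seq Y).

Let xof y : X := (basis_dec X (val y)).1.
Let hof y : G := (basis_dec X (val y)).2.

Let xhofP y : val y = ract (val (xof y)) (hof y).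
Proof. exact: basis_decP. Qed.

Let xof_letter g y : xof (letter g y) = letter g (xof y) /\
  (hof (letter g y) * sect1 g y = sect1 g (xof y) * hof y)%g.
Proof.
have := letter_sectP g y; rewrite xhofP lractC letter_sectP (xhofP (letter g y)).
rewrite -!ractM => /(congr1 (basis_dec X)); rewrite !basis_decE.
by case=> -> ->.
Qed.

(** In the tensor powers of the biset, where a word over [Y] is the tensor
    product of its letters, [g . v = u . carry g v] for a word [u] over [X]. *)
Let carry g v : G := foldl (fun g y => sect1 g (xof y) * hof y)%g g v.

Let carry_wact h g v :
  (carry h (wact g v) * sect g v = carry (h * g) v)%g.
Proof.
elim: v h g => //= y v IHv h g; have [xl hl] := xof_letter g y.
by rewrite IHv -mulgA hl xl sect1M !mulgA.
Qed.

Let carryM h g v : exists2 u : seq X, size u = size v &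
  carry (h * g)%g v = (sect h u * carry g v)%g.
Proof.
elim: v h g => [|y v IHv] h g /=; first by exists [::].
have [u uv E] := IHv (sect1 h (letter g (xof y))) (sect1 g (xof y) * hof y)%g.
exists (letter g (xof y) :: u); first by rewrite /= uv.
by rewrite sect1M -mulgA E.
Qed.

(** Sections at words of a fixed length [m] have half the word length, by
    contraction, so that rewriting a long word letter by letter only meets
    group elements of bounded length. *)
Let carry_finite (N : set G) : finite_set N -> absorbing X N ->
  finite_set [set carry 1 v | v in [set: seq Y]].
Proof.
move=> finN absN; have contr : exists N : set G, finite_set N /\ absorbing X N.
  by exists N.
pose A := [set 1%g] `|` [set hof y | y in [set: Y]] `|` N.
have finA : finite_set A.
  by rewrite !finite_setU; do !split=> //; exact/finite_image/finite_basis.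
pose S := [set h | exists g (v : seq X), A g /\ h = sect g v].
have finS : finite_set S by exact: finite_sections finN absN finA.
have scS : sect_closed X S.
  by move=> _ v [g [u [Ag ->]]]; exists g, (u ++ v); rewrite sect_cat.
have AS : A `<=` S by move=> g Ag; exists g, [::].
have S1 : S 1%g by apply: AS; left; left.
have [m [m_gt0 mP]] : exists m, 0 < m /\
    forall g u, prods S 2 g -> m <= size u -> S (sect g (u : seq X)).
  have [m mP] := nucleus_absorbing_finite contr (prods_finite 2 finS).
  exists m.+1; split=> // g u Sg mu; apply: AS; right.
  by have := mP _ _ Sg (ltnW mu); apply; split.
have halve k g (u : seq X) : prods S k.*2 g -> m <= size u -> prods S k (sect g u).
  elim: k g u => [|k IHk] g u; first by move=> -> _; rewrite /= sect_w1.
  move=> [a Sa [_ [b Sb [c Sc <-]] <-]] mu; rewrite mulgA sectM.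
  exists (sect (a * b)%g (wact c u)).
    by apply: mP; [exact: (prodsM (j := 1) (prods1 Sa) (prods1 Sb))
                  | rewrite size_wact].
  by exists (sect c u) => //; exact: IHk.
have carry_le k g v : prods S k g -> prods S (k + size v) (carry g v).
  elim: v k g => [|y v IHv] k g Sg /=; first by rewrite addn0.
  rewrite addnS -addSn; apply: IHv; rewrite -addn1; apply: prodsM.
    exact: (prods_sect scS [:: xof y]).
  by apply/prods1/AS; left; right; exists y.
(* Reading [m] letters takes a product of [2 * m] elements to one of [m], and
   the letters themselves contribute [m] more, whence the bound [2 * m]. *)
suff sub k v g : size v <= k -> prods S m.*2 g -> prods S (m.*2 + m) (carry g v).
  apply: sub_finite_set (prods_finite (m.*2 + m) finS) => _ [v _ <-].
  by apply: (sub (size v)) => //; exact: (@prods_le _ S 0).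
elim: k v g => [|k IHk] v g vk Sg.
  by apply: prods_le (carry_le _ _ _ Sg) => //; rewrite leq_add2l (leq_trans vk).
have [vm|mv] := leqP (size v) m.
  by apply: prods_le (carry_le _ _ _ Sg) => //; rewrite leq_add2l.
rewrite -(cat_take_drop m v) /carry foldl_cat -!/(carry _ _).
apply: IHk.
  by rewrite size_drop leq_subLR (leq_trans vk) // -add1n leq_add2r.
have szm : size (take m v) = m by rewrite size_takel // ltnW.
have [u uv] := carryM g 1%g (take m v); rewrite mulg1 => ->.
rewrite -addnn; apply: prodsM; first by apply: halve; rewrite // uv szm.
by rewrite -{1}szm; exact: (carry_le 0).
Qed.

Lemma absorbing_basis : (exists N : set G, finite_set N /\ absorbing X N) ->
  exists N : set G, finite_set N /\ absorbing Y N.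
Proof.
move=> [N [finN absN]]; have finE := carry_finite finN absN.
set E := [set _ | _ in _] in finE.
exists [set (a^-1 * b)%g | a in E & b in [set (c * e)%g | c in N & e in E]].
split; first exact/finite_image2/finite_image2.
move=> g; have [n nP] := absN g; exists n => v nv.
have [u uv cE] := carryM g 1%g v; rewrite mulg1 in cE.
have := carry_wact 1%g g v; rewrite mul1g cE => sE.
exists (carry 1 (wact g v)); first by exists (wact g v).
exists (sect g u * carry 1 v)%g; last by rewrite -sE mulKg.
by exists (sect g u); [apply: nP; rewrite uv | exists (carry 1 v) => //; exists v].
Qed.

End BasisChange.

Lemma contracting_basis (G : groupType) (B : biset G) (X : biset_basis B) :
  contracting B -> exists N : set G, finite_set N /\ absorbing X N.
Proof. by move=> [Y /absorbing_basis]; apply. Qed.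

(** * Words, cylinders and compactness *)

Section Cylinders.
Variables (G : groupType) (B : biset G) (X : biset_basis B).
Implicit Types (g h : G) (u v w : seq X) (y z : seqs X) (F : set G).

Definition suf (T : Type) t (u : seq T) := drop (size u - t) u.

Lemma size_suf (T : Type) t (u : seq T) : t <= size u -> size (suf t u) = t.
Proof. by move=> tu; rewrite size_drop subKn. Qed.

Lemma suf_suf (T : Type) s t (u : seq T) :
  s <= t <= size u -> suf s (suf t u) = suf s u.
Proof.
move=> /andP[st tu]; rewrite /suf drop_drop size_drop subKn //.
by rewrite addnC addnBA // subnK.
Qed.

Lemma size_lword z n : size (lword z n) = n.
Proof. by rewrite size_rev size_mkseq. Qed.

Lemma suf_lword z s t : s <= t -> suf s (lword z t) = lword z s.
Proof.
move=> st; rewrite /suf size_lword -{2}(subnKC st).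
by have [w <- ->] := lwordD z s (t - s); rewrite drop_size_cat.
Qed.

Lemma wact_suf g u t :
  suf t (wact g u) = wact (sect g (take (size u - t) u)) (suf t u).
Proof.
rewrite /suf size_wact; set k := size u - t.
rewrite -{1}(cat_take_drop k u) wact_cat.
rewrite drop_size_cat // size_wact size_takel ?leq_subr //.
Qed.

Lemma sect_suf g u t :
  sect g u = sect (sect g (take (size u - t) u)) (suf t u).
Proof. by rewrite -sect_cat cat_take_drop. Qed.

Lemma lword_mkseq y z n : lword y n = lword z n <-> mkseq y n = mkseq z n.
Proof. by split=> [/(can_inj revK)|] //; rewrite /lword => ->. Qed.

Lemma lword_le y z m n :
  m <= n -> lword y n = lword z n -> lword y m = lword z m.
Proof. by move=> mn yz; rewrite -(suf_lword y mn) yz suf_lword. Qed.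

Lemma nbhs_cylinder z (O : set (seqs X)) :
  nbhs z O <-> exists n, forall y, mkseq y n = mkseq z n -> O y.
Proof.
split=> [|[n nO]]; last by apply: filterS (nbhs_prefix z n).
pose cyl : set_system (seqs X) :=
  [set P | exists n, forall y, mkseq y n = mkseq z n -> P y].
have fcyl : Filter cyl.
  split=> [|P Q [m mP] [n nQ]|P Q PQ [m mP]]; first by exists 0.
    exists (maxn m n) => y /lword_mkseq yz.
    split; [apply: mP|apply: nQ]; apply/lword_mkseq.
      exact: lword_le (leq_maxl m n) yz.
    exact: lword_le (leq_maxr m n) yz.
  by exists m => y /mP/PQ.
suff : cyl --> z by apply.
apply/cvg_sup => n U.
rewrite (@nbhsE (initial_topology (fun f : seqs X => f n))) => -[_ [[C oC <-] Cz]].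
move=> sCU; exists n.+1 => y; rewrite !mkseqS => /rcons_inj[_ yn].
by apply: sCU; rewrite /preimage /= yn.
Qed.

Lemma open_cylinder (O : set (seqs X)) : open O <->
  forall z, O z -> exists n, forall y, lword y n = lword z n -> O y.
Proof.
rewrite openE; split=> oO z Oz.
  have /nbhs_cylinder[n nO] := oO z Oz.
  by exists n => y /lword_mkseq/nO.
apply/nbhs_cylinder; have [n nO] := oO z Oz.
by exists n => y /lword_mkseq/nO.
Qed.

Lemma seqs_compact : compact [set: seqs X].
Proof.
have := @tychonoff nat (fun=> discrete_topology X) (fun=> setT).
rewrite (_ : [set f | _] = setT); last by apply/seteqP; split.
apply=> _; exact/finite_compact/finite_basis.
Qed.

Lemma seqs_cluster (s : nat -> seqs X) : exists z, forall n m, exists2 k,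
  m <= k & lword (s k) n = lword z n.
Proof.
have [z [_ zP]] := seqs_compact
  (fmap_proper_filter s eventually_filter) filterT.
exists z => n m.
have sm : (s @ \oo) [set s k | k in [set k | m <= k]].
  by exists m => // k mk; exists k.
have [_ [[k mk <-] /lword_mkseq E]] := zP _ _ sm (nbhs_prefix z n).
by exists k.
Qed.

(** A version of the Lebesgue number lemma. *)
Lemma cylinder_cover I (O : I -> set (seqs X)) :
    (forall i, open (O i)) -> (forall z, exists i, O i z) ->
  exists D, forall z, exists i, forall y, lword y D = lword z D -> O i y.
Proof.
move=> oO covO; apply: contrapT => /forallNP noD.
have /choice[s sP] : forall D, exists z, ~ exists i, forall y,
  lword y D = lword z D -> O i y by move=> D; exact/existsNP/noD.
have [z zP] := seqs_cluster s; have [i Oz] := covO z.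
have [n nO] := (open_cylinder _).1 (oO i) z Oz.
have [k nk kz] := zP n n; apply: (sP k); exists i => y ky.
by apply: nO; rewrite -kz; exact: lword_le ky.
Qed.

End Cylinders.

(** * The asymptotic relation and its saturated open sets *)

Section Asymptotic.
Variables (G : groupType) (B : biset G) (X : biset_basis B).
Implicit Types (g h : G) (u v w : seq X) (y z : seqs X) (F : set G).
Implicit Types (O : set (seqs X)).

(** When [F] is the nucleus, this is adjacency in the graph on the words of a
    given length that approximates the limit space. *)
Definition moves F u w := exists2 h, F h & wact h u = w.

Lemma moves_suf F t u w :
  sect_closed X F -> moves F u w -> moves F (suf t u) (suf t w).
Proof.
move=> scF [h Fh <-]; rewrite wact_suf.
by exists (sect h (take (size u - t) u)) => //; exact: scF.
Qed.

Lemma moves_prods F j k u v w : moves (prods F j) u v ->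
  moves (prods F k) v w -> moves (prods F (k + j)) u w.
Proof.
move=> [g Fg <-] [h Fh <-]; exists (h * g)%g; last by rewrite wactM.
exact: prodsM.
Qed.

Definition saturated O := forall y z, asymp_equiv y z -> O y -> O z.

Section Contracting.
Hypothesis contr : exists N : set G, finite_set N /\ absorbing X N.
Local Notation N := (nucleus X).

Lemma moves_refl u : 0 < size u -> moves N u u.
Proof. by case: u => // x u _; exists 1%g; [exact: (nucleus1 x) | exact: wact1].
Qed.

Lemma moves_nucleusV u w : moves N u w -> moves N w u.
Proof.
move=> [h Nh <-]; exists h^-1%g; first exact: nucleusV.
by rewrite -wactM mulVg wact1.
Qed.

Lemma moves_nucleus_suf t u w : moves N u w -> moves N (suf t u) (suf t w).
Proof. exact: moves_suf (nucleus_sect contr). Qed.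

(** Contraction turns any finite set of moves into moves by the nucleus, at the
    price of forgetting a bounded number of letters. *)
Lemma moves_contract F : finite_set F -> exists k, forall t u w,
  t + k <= size u -> moves F u w -> moves N (suf t u) (suf t w).
Proof.
move=> finF; have [k kP] := nucleus_absorbing_finite contr finF.
exists k => t u w tku [h Fh <-]; rewrite wact_suf.
exists (sect h (take (size u - t) u)) => //; apply: kP => //.
rewrite size_takel ?leq_subr // leq_subRL //.
exact: leq_trans (leq_addr _ _) tku.
Qed.

Lemma asymp_limit F y z : finite_set F ->
  (forall m, exists2 l, m <= l & moves F (lword y l) (lword z l)) ->
  asymp_equiv y z.
Proof.
move=> finF yz; have [k kP] := moves_contract finF.
suff /choice[g gP] : forall n, exists g, N g /\ wact g (lword y n) = lword z n.
  by exists g.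
move=> n; have [l nkl /kP] := yz (n + k).
move=> /(_ n); rewrite size_lword => /(_ nkl) [g Ng].
have nl : n <= l by rewrite (leq_trans _ nkl) ?leq_addr.
by rewrite !suf_lword // => E; exists g.
Qed.

Lemma asymp_moves y z n : asymp_equiv y z -> moves N (lword y n) (lword z n).
Proof. by move=> [g /(_ n)[Ng <-]]; exists (g n). Qed.

Lemma asymp_nbhs F O y : finite_set F -> open O ->
    (forall z, asymp_equiv y z -> O z) ->
  exists l, forall z, moves F (lword y l) (lword z l) -> O z.
Proof.
move=> finF oO yO; apply: contrapT => /forallNP no.
have /choice[s sP] : forall l, exists z,
    moves F (lword y l) (lword z l) /\ ~ O z.
  by move=> l; have /existsNP[z /not_implyP] := no l; exists z.
have [k kP] := moves_contract finF.
have [z zP] := seqs_cluster s.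
have Oz : O z.
  apply: yO; apply: asymp_limit (nucleus_finite contr) _ => n.
  exists n => //; have [l nkl <-] := zP n (n + k).
  have nl : n <= l by rewrite (leq_trans _ nkl) ?leq_addr.
  rewrite -(suf_lword _ nl) -(suf_lword (s l) nl).
  by apply: kP; [rewrite size_lword | exact: (sP l).1].
have [n nO] := (open_cylinder _).1 oO z Oz.
by have [l _ /nO] := zP n 0; exact: (sP l).2.
Qed.

(** The Lebesgue number lemma for the limit space. *)
Lemma saturated_cover F I (O : I -> set (seqs X)) : finite_set F ->
    (forall i, open (O i)) -> (forall i, saturated (O i)) ->
    (forall z, exists i, O i z) ->
  exists D, forall l, D <= l -> forall z, exists i, forall y,
    moves F (lword z l) (lword y l) -> O i y.
Proof.
move=> finF oO satO covO; apply: contrapT => /forallNP no.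
have /choice[p pP] : forall D, exists p : nat * seqs X, D <= p.1 /\
    forall i, ~ forall y, moves F (lword p.2 p.1) (lword y p.1) -> O i y.
  move=> D; have /existsNP[l /not_implyP[Dl /existsNP[z /forallNP]]] := no D.
  by exists (l, z).
have [k kP] := moves_contract finF.
have [z zP] := seqs_cluster (snd \o p); have [i Oz] := covO z.
have [n nO] := asymp_nbhs (nucleus_finite contr) (oO i)
  (fun y zy => satO i z y zy Oz).
have [D nkD /= Dz] := zP n (n + k); have [Dl] := pP D.
have nkl := leq_trans nkD Dl.
have nl : n <= (p D).1 by rewrite (leq_trans _ nkl) ?leq_addr.
move=> /(_ i); apply=> y My; apply: nO; rewrite -Dz.
rewrite -(suf_lword _ nl) -(suf_lword y nl).
by apply: kP My; rewrite size_lword.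
Qed.

(** This is the largest open saturated subset of [O], since by [asymp_nbhs] an
    open saturated set around [z] contains all points that are close to [z] in
    the sense of [moves]. *)
Definition sat_interior O : set (seqs X) :=
  [set z | exists l, forall y, moves N (lword z l) (lword y l) -> O y].

Lemma sat_interior_sub O : sat_interior O `<=` O.
Proof.
move=> z [l]; apply; exists 1%g; last exact: wact1.
exact: (nucleus1 (z 0)).
Qed.

Lemma sat_interior_open O : open (sat_interior O).
Proof.
by apply/open_cylinder => z [l lO]; exists l => y yz; exists l; rewrite yz.
Qed.

Lemma sat_interior_saturated O : saturated (sat_interior O).
Proof.
move=> y z yz [l lO].
have [k kP] := moves_contract (prods_finite 2 (nucleus_finite contr)).
exists (l + k) => t zt; apply: lO.
have ll := leq_addr k l; rewrite -(suf_lword _ ll) -(suf_lword t ll).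
apply: kP; first by rewrite size_lword.
have [g Ng gE] := asymp_moves (l + k) yz; have [h Nh hE] := zt.
apply: (@moves_prods _ 1 1 _ (lword z (l + k))).
  by exists g => //; exact: prods1.
by exists h => //; exact: prods1.
Qed.

(** ** The limit space *)

Definition limit_pi (z : seqs X) : limit_space X :=
  (\pi_({eq_quot limit_equiv X}%qT) z)%qT.

Lemma limit_piP y z : limit_pi y = limit_pi z <-> asymp_equiv y z.
Proof.
split=> [/eqmodP/(limit_relP contr)//|yz]; apply/eqmodP; exact/limit_relP.
Qed.

Lemma limit_pi_surj (a : limit_space X) : exists z, limit_pi z = a.
Proof. by exists (repr (a : {eq_quot limit_equiv X}%qT)); exact: reprK. Qed.

Lemma limit_pi_open (U : set (limit_space X)) :
  open (limit_pi @^-1` U) = open U.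
Proof. by []. Qed.

Lemma preimage_limit_pi O : saturated O -> limit_pi @^-1` (limit_pi @` O) = O.
Proof.
move=> satO; apply/seteqP; split=> [z [y Oy /limit_piP yz]|z Oz].
  exact: satO yz Oy.
by exists z.
Qed.

End Contracting.
End Asymptotic.

(** * From uniformly bounded components to coverings of the limit space *)

Section Components.
Variables (G : groupType) (B : biset G) (X : biset_basis B) (d : nat).
Implicit Types (g h : G) (u v w : seq X) (y z : seqs X) (F : set G).
Hypothesis contr : exists N : set G, finite_set N /\ absorbing X N.
Local Notation N := (nucleus X).
Local Notation limit_pi := (@limit_pi G B X).

(** The form in which both finiteness conditions, on the tree and on the
    groupoid of germs, act on the limit space: the colour of a word is that of
    its prefix of length [n], the relation [E i] contains the adjacency by the
    nucleus inside the colour [i], and its classes lie in orbits of one finite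
    set [F], whatever the length of the words. *)
Definition bounded_components : Prop :=
  exists n (V : 'I_d.+1 -> set (seq X))
         (E : 'I_d.+1 -> seq X -> seq X -> Prop) F,
  [/\ forall w, size w = n -> exists i, V i w,
      finite_set F,
      forall i u v, V i (take n u) -> V i (take n v) -> moves N u v -> E i u v,
      forall i u v, E i u v -> [/\ E i v u, V i (take n v) & moves F u v]
    & forall i u v w, E i u v -> E i v w -> E i u w].

Lemma lword_extend z u : exists y, lword y (size u) = u.
Proof.
exists (fun k => if k < size u then nth (z 0) (rev u) k else z k).
rewrite -[RHS]revK /lword; congr rev; apply: (@eq_from_nth _ (z 0)).
  by rewrite size_mkseq size_rev.
by move=> k; rewrite size_mkseq => ku; rewrite nth_mkseq // ku.
Qed.

(** The tiles of the words in one class of [E i], for words of length [m],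
    form a small closed set, and distinct classes of one colour give disjoint
    ones. The saturated interiors of slightly larger clopen sets keep both
    properties: two of them can only meet when their classes are adjacent. *)
Lemma bounded_components_covering_dim :
  bounded_components -> covering_dim_le (limit_space X) d.
Proof.
move=> [n [V [E [F [covV finF stepE EF transE]]]]] U finU oU covU.
have [[z0 _]|noz] := pselect (exists z : seqs X, True); last first.
  exists set0; split=> //.
  - apply/seteqP; split=> // a _; have [z _] := limit_pi_surj a.
    by case: noz; exists z.
  - by move=> a; have [z _] := limit_pi_surj a; case: noz; exists z.
pose O (a : set (limit_space X)) := [set z | U a /\ a (limit_pi z)].
have oO a : open (O a).
  have [Ua|nUa] := pselect (U a); last first.
    by rewrite (_ : O a = set0); [exact: open0 | apply/seteqP; split=> // z []].
  rewrite (_ : O a = limit_pi @^-1` a); first exact: oU.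
  by apply/seteqP; split=> [z []|z].
have satO a : saturated (O a).
  by move=> y z /(limit_piP contr) yz [Ua ay]; split=> //; rewrite -yz.
have covO z : exists a, O a z.
  have : [set: limit_space X] (limit_pi z) by [].
  by rewrite -covU => -[a Ua az]; exists a.
have finNF : finite_set [set (h * f)%g | h in N & f in F].
  by apply: finite_image2 => //; exact: nucleus_finite contr.
have [D DP] := saturated_cover contr finNF oO satO covO.
(* The nucleus contains 1 as soon as there is a letter; the successor keeps the
   words nonempty. *)
pose m := (n + D).+1.
have nm : n <= m by rewrite /m ltnW // ltnS leq_addr.
have [k kP] := moves_contract contr (prods_finite 2 (nucleus_finite contr)).
have mk := leq_addr k m.
pose fat i u : set (seqs X) := [set z | exists y,
  E i u (lword y m) /\ moves N (lword y (m + k)) (lword z (m + k))].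
pose W i u := sat_interior (fat i u).
have EE i u : V i (take n u) -> size u = m -> E i u u.
  by move=> Vu um; apply: stepE => //; apply: moves_refl; rewrite um.
have fat_moves i u z : fat i u z -> exists w, E i u w /\ moves N w (lword z m).
  move=> [y [Ey My]]; exists (lword y m); split=> //.
  by rewrite -(suf_lword y mk) -(suf_lword z mk); exact: moves_nucleus_suf.
have W_uniq i u v z : W i u z -> W i v z -> E i u v.
  move=> /sat_interior_sub[y [Ey My]] /sat_interior_sub[y' [Ey' My']].
  have [Vy Vy'] := (EF _ _ _ Ey, EF _ _ _ Ey').
  case: Vy Vy' => _ Vy _ [Ey'V Vy' _].
  apply: (transE _ _ _ _ Ey); apply: (transE _ _ _ _ _ Ey'V); apply: stepE => //.
  rewrite -(suf_lword y mk) -(suf_lword y' mk).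
  apply: kP; first by rewrite size_lword.
  have [h Nh hE] := My; have [h' Nh' hE'] := moves_nucleusV My'.
  apply: (@moves_prods _ _ _ _ 1 1 _ (lword z (m + k))).
    by exists h => //; exact: prods1.
  by exists h' => //; exact: prods1.
have W_eq i u v : E i u v -> W i u = W i v.
  move=> Euv; have [Evu _ _] := EF _ _ _ Euv; rewrite /W; congr sat_interior.
  apply/seteqP; split=> z [y [Ey My]]; exists y; split=> //.
    exact: transE Evu Ey.
  exact: transE Euv Ey.
exists [set limit_pi @` W p.1 p.2 |
  p in [set p | size p.2 = m /\ V p.1 (take n p.2)]].
split.
- apply: finite_image.
  apply: sub_finite_set
    (finite_setX (@finite_finset _ [set: 'I_d.+1]) (finite_words X m)).
  by move=> [i u] [].
- move=> _ [[i u] _ <-]; rewrite -limit_pi_open preimage_limit_pi //.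
    exact: sat_interior_open.
  exact: sat_interior_saturated.
- apply/seteqP; split=> // a _; have [z <-] := limit_pi_surj a.
  have [i Vi] : exists i, V i (take n (lword z m)).
    by apply: covV; rewrite size_takel ?size_lword.
  exists (limit_pi @` W i (lword z m)).
    by exists (i, lword z m); rewrite //= size_lword.
  exists z => //; exists (m + k) => y zy; exists z; split=> //.
  by apply: EE; rewrite ?size_lword.
- move=> _ [[i u] /= [um Vu] <-].
  have [y yu] := lword_extend z0 u; rewrite um in yu.
  have [a aP] := DP m (leq_trans (leq_addl n D) (leqnSn _)) y.
  have Oa w x : E i u w -> moves N w (lword x m) -> O a x.
    move=> /EF[_ _ [f Ff fE]] [h Nh hE]; apply: aP.
    exists (h * f)%g; first by exists h => //; exists f.
    by rewrite wactM yu fE.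
  exists a.
    have [] // := Oa u y; first exact: EE.
    by rewrite yu; apply: moves_refl; rewrite um.
  move=> _ [z /sat_interior_sub/fat_moves[w [Ew Mw]] <-].
  by have [] := Oa w z Ew Mw.
- move=> a; have [z za] := limit_pi_surj a.
  pose C i := limit_pi @` [set y | exists u, W i u z /\ W i u y].
  apply: (@card_le_trans _ _ _ (range C)).
    apply: subset_card_le => v [[[i u] /= [um Vu] <-]].
    rewrite -za => -[y Wy /(limit_piP contr) yz].
    have Wz : W i u z by exact: sat_interior_saturated yz Wy.
    exists i => //; rewrite /C; congr (_ @` _); apply/seteqP; split=> x.
      by move=> [w [Ww Wx]]; rewrite (W_eq i u w) //; exact: W_uniq Wz Ww.
    by move=> Wx; exists u.
  apply: card_le_trans (card_image_le _ _) _.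
  by have := @card_II d.+1; rewrite card_eq_le => /andP[].
Qed.

End Components.

(** * Groupoids of isomorphisms of subtrees *)

Section SubtreeMaps.
Variables (G : groupType) (B : biset G) (X : biset_basis B) (d : nat).
Implicit Types (g h : G) (u v w : seq X) (z : seqs X).

Lemma generated_bij_groupoid (T : Type) (S : set (set (T * T))) :
  bij_groupoid (generated_groupoid S).
Proof.
split=> [f Sf|f g Sf Sg fg] H HS; first exact: HS.1.1 (Sf H HS).
exact: HS.1.2 (Sf H HS) (Sg H HS) fg.
Qed.

Lemma subtree_mapP g v w w' :
  subtree_map g v (w, w') <-> prefix v w /\ w' = wact g w.
Proof.
split=> [[_ vw [<- <-]]|[vw ->]] //.
by exists w.
Qed.

Lemma prefix_wact g v w : prefix (wact g v) (wact g w) = prefix v w.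
Proof.
have sub h (t s : seq X) : prefix t s -> prefix (wact h t) (wact h s).
  by move=> /prefixP[r ->]; rewrite wact_cat; exact: prefix_prefix.
apply/idP/idP; last exact: sub.
by move=> /(sub g^-1%g); rewrite -!wactM mulVg !wact1.
Qed.

Lemma subtree_map_inv g v :
  ((subtree_map g v)^-1)%relation = subtree_map g^-1%g (wact g v).
Proof.
apply/seteqP; split=> -[w w'] /=.
  by move=> /subtree_mapP[vw ->]; apply/subtree_mapP; rewrite prefix_wact -wactM
    mulVg wact1.
move=> /subtree_mapP[vw ->]; apply/subtree_mapP.
by rewrite -(prefix_wact g) -wactM mulgV wact1.
Qed.

Lemma subtree_map_comp g h v :
  (subtree_map h (wact g v) \; subtree_map g v)%relation =
  subtree_map (h * g)%g v.
Proof.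
apply/seteqP; split=> -[w w'] /=.
  move=> [t /subtree_mapP[vw ->] /subtree_mapP[_ ->]].
  by apply/subtree_mapP; rewrite wactM.
move=> /subtree_mapP[vw ->]; exists (wact g w); apply/subtree_mapP; split=> //.
  by rewrite prefix_wact.
exact: wactM.
Qed.

Lemma fst_subtree_map g v : fst @` subtree_map g v = [set w | prefix v w].
Proof.
apply/seteqP; split=> [_ [[w w'] /subtree_mapP[vw _] <-] //|w vw].
by exists (w, wact g w) => //; apply/subtree_mapP.
Qed.

Lemma snd_subtree_map g v :
  snd @` subtree_map g v = [set w | prefix (wact g v) w].
Proof.
rewrite -(fst_subtree_map g^-1%g) -subtree_map_inv.
by apply/seteqP; split=> w [[a b] ab <-]; exists (b, a).
Qed.

Lemma prefix_set_inj u v :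
  [set w | prefix u w] = [set w | prefix v w] -> u = v.
Proof.
move=> uv.
have : [set w | prefix v w] u by rewrite -uv /= prefix_refl.
have : [set w | prefix u w] v by rewrite uv /= prefix_refl.
move=> /= /prefixP[s ->] /prefixP[t] /(congr1 size).
rewrite !size_cat -addnA => /eqP; rewrite -{1}[size u]addn0 eqn_add2l eq_sym.
by rewrite addn_eq0 size_eq0 => /andP[/eqP -> _]; rewrite cats0.
Qed.

Definition tree_generators (A : set G) (V : set (seq X)) :
    set (set (seq X * seq X)) :=
  [set f | exists g v, [/\ A g, V v, V (wact g v) & f = subtree_map g v]].

Lemma generated_subtreeV S g v :
  generated_groupoid S (subtree_map g v) ->
  generated_groupoid S (subtree_map g^-1%g (wact g v)).
Proof. by rewrite -subtree_map_inv; apply: (generated_bij_groupoid S).1. Qed.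

Lemma generated_subtreeM S g h v :
  generated_groupoid S (subtree_map h (wact g v)) ->
  generated_groupoid S (subtree_map g v) ->
  generated_groupoid S (subtree_map (h * g)%g v).
Proof.
rewrite -subtree_map_comp => Sh Sg.
by apply: (generated_bij_groupoid S).2; rewrite // fst_subtree_map snd_subtree_map.
Qed.

Lemma take_wact g n u : take n (wact g u) = wact g (take n u).
Proof.
have [nu|un] := leqP n (size u); last by rewrite !take_oversize ?size_wact // ltnW.
rewrite -{1}(cat_take_drop n u) wact_cat take_size_cat // size_wact size_takel //.
Qed.

Definition subtree_rep (f : set (seq X * seq X)) : G :=
  xget 1%g [set g | exists v, f = subtree_map g v].

Lemma subtree_repE g v : subtree_map (subtree_rep (subtree_map g v)) v =
  subtree_map g v :> set (seq X * seq X).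
Proof.
have : exists v', subtree_map g v = subtree_map (subtree_rep (subtree_map g v)) v'.
  have ex : exists h v', subtree_map g v = subtree_map h v' by exists g, v.
  exact: (xgetPex 1%g ex).
move=> [v' E]; suff vv' : v = v' by rewrite [RHS]E -vv'.
by apply: prefix_set_inj; rewrite -(fst_subtree_map g) E fst_subtree_map.
Qed.

Lemma subtree_rep_wact g v w : prefix v w ->
  wact (subtree_rep (subtree_map g v)) w = wact g w.
Proof.
move=> vw; suff /subtree_mapP[_ <-] :
  subtree_map (subtree_rep (subtree_map g v)) v (w, wact g w) by [].
by rewrite subtree_repE; apply/subtree_mapP.
Qed.

Lemma prefix_take n u : prefix (take n u) u.
Proof. by apply/prefixP; exists (drop n u); rewrite cat_take_drop. Qed.

Lemma tree_condition_bounded_components :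
  (exists N : set G, finite_set N /\ absorbing X N) ->
  tree_condition X d (nucleus X) -> bounded_components X d.
Proof.
move=> contr [n [V [n_gt0 covV _ finV]]].
pose Gen (i : 'I_d.+1) := generated_groupoid (tree_generators (nucleus X) (V i)).
pose E i u v := [/\ V i (take n u), V i (take n v) &
  exists2 g, Gen i (subtree_map g (take n u)) & wact g u = v].
exists n, V, E, (\bigcup_(i in [set: 'I_d.+1]) (subtree_rep @` Gen i)); split.
- move=> w wn; have : (\bigcup_i V i) w by rewrite covV.
  by move=> [i _ Vw]; exists i.
- by apply: bigcup_finite => // i _; exact/finite_image/finV.
- move=> i u v Vu Vv [g Ng gu]; split=> //; exists g => //.
  apply: sub_gen_smallest; exists g, (take n u); split=> //.
  by rewrite -take_wact gu.
- move=> i u v [Vu Vv [g Gg gu]]; split=> //.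
    split=> //; exists g^-1%g; last by rewrite -gu -wactM mulVg wact1.
    by rewrite -gu take_wact; exact: generated_subtreeV.
  exists (subtree_rep (subtree_map g (take n u))).
    by exists i => //; exists (subtree_map g (take n u)).
  by rewrite subtree_rep_wact // prefix_take.
- move=> i u v w [Vu Vv [g Gg gu]] [_ Vw [h Gh hv]]; split=> //.
  exists (h * g)%g; last by rewrite wactM gu.
  by apply: generated_subtreeM Gg; rewrite -take_wact gu.
Qed.

End SubtreeMaps.

(** * The groupoid of germs *)

Section Germs.
Variables (G : groupType) (B : biset G) (X : biset_basis B) (d : nat).
Implicit Types (g h : G) (u v w : seq X) (z : seqs X).
Local Notation germ_pi := (@germ_pi G B X).

(** The compact open bisection of all germs of [g]. *)
Definition germs_of g : set (germ X) := [set germ_pi (g, z) | z in [set: seqs X]].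

Lemma germ_pi_section_continuous g : continuous (fun z => germ_pi (g, z)).
Proof. by move=> z W /germ_nbhs. Qed.

Lemma germs_of_compact g : compact (germs_of g).
Proof.
apply: continuous_compact (seqs_compact (X := X)).
exact/continuous_subspaceT/germ_pi_section_continuous.
Qed.

Lemma finite_bigcup_compact (T : topologicalType) (I : choiceType) (A : set I)
    (K : I -> set T) :
  finite_set A -> (forall i, A i -> compact (K i)) ->
  compact (\bigcup_(i in A) K i).
Proof.
move=> /finite_seqP[s ->] cK; rewrite bigcup_seq big_seq.
by apply: bigsetU_compact => i si; apply: cK.
Qed.

Lemma compact_germs (K : set (germ X)) : compact K ->
  exists A : set G, finite_set A /\ K `<=` \bigcup_(g in A) germs_of g.
Proof.
move=> /compact_near_coveringP cK.
(* Finite sequences in [G], directed by inclusion. *)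
pose fine : set_system (seq G) :=
  [set P | exists s : seq G, forall t : seq G, {subset s <= t} -> P t].
have ffine : Filter fine.
  split=> [|P Q [s sP] [t tQ]|P Q PQ [s sP]]; first by exists [::].
    exists (s ++ t) => r str; split; [apply: sP|apply: tQ] => g gs; apply: str.
      by rewrite mem_cat gs.
    by rewrite mem_cat gs orbT.
  by exists s => t /sP/PQ.
have [|s sP] := cK _ fine (fun s a => exists2 g, g \in s & germs_of g a) ffine.
  move=> a _; rewrite -(germ_reprK a); set p := germ_repr a.
  exists (germs_of p.1, [set s | p.1 \in s]) => /=; last first.
    by move=> [b s] [/= pb ps]; exists p.1.
  split; first by apply: germ_nbhsP; apply: filterE => z; exists z.
  by exists [:: p.1] => t; apply; rewrite mem_head.
exists [set` s]; split; first exact: finite_seq.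
by move=> a /(sP s (fun _ => id))[g gs ag]; exists g.
Qed.

Lemma germs_of_bigcup_compact (A : set G) :
  finite_set A -> compact (\bigcup_(g in A) germs_of g).
Proof.
move=> finA; apply: finite_bigcup_compact => // g _; exact: germs_of_compact.
Qed.

Lemma mkseq_prefix z m n : m <= n -> prefix (mkseq z m) (mkseq z n).
Proof.
move=> /subnKC <-; apply/prefixP; exists [seq z i | i <- iota m (n - m)].
by rewrite /mkseq iotaD map_cat.
Qed.

Lemma take_mkseq z m n : m <= n -> take m (mkseq z n) = mkseq z m.
Proof.
by move=> /(mkseq_prefix z) /prefixP[s ->]; rewrite take_size_cat // size_mkseq.
Qed.

Lemma mkseq_ext (y z : seqs X) :
  (exists n, forall m, n <= m -> mkseq y m = mkseq z m) -> y = z.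
Proof.
move=> [n E]; apply: funext => k.
have := E (n + k).+1 (leq_trans (leq_addr k n) (leqnSn _)).
move=> /(congr1 (fun s => nth (z 0) s k)).
by rewrite !nth_mkseq // ltnS leq_addl.
Qed.

(** A compact subgroupoid is covered by the germs of finitely many elements of
    [G]. It contains the germs of a product of nucleus elements along a path
    that stays in one colour, so that the end of the path is in the orbit of
    its beginning under these finitely many elements. *)
Lemma dyn_asdim_bounded_components :
  (exists N : set G, finite_set N /\ absorbing X N) ->
  dyn_asdim_le (germ_groupoid X) d -> bounded_components X d.
Proof.
move=> contr /(_ _ (germs_of_bigcup_compact (nucleus_finite contr))).
move=> [U [oU covU /choice[H HP]]].
have [D DP] : exists D, forall z, exists i, forall y,
    lword y D = lword z D -> U i y.
  apply: cylinder_cover => // z; have : [set: seqs X] z by [].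
  by rewrite -covU => -[i _ Uz]; exists i.
have /choice[F FP] i : exists A : set G,
    finite_set A /\ H i `<=` \bigcup_(g in A) germs_of g.
  by have [_ cH _] := HP i; exact: compact_germs.
pose n := D.+1.
pose V i := [set w : seq X | size w = n /\ forall z, mkseq z n = w -> U i z].
pose E i u v := [/\ V i (take n u), V i (take n v) & exists2 g, wact g u = v &
  forall z, mkseq z (size u) = u -> H i (germ_pi (g, z))].
have sizeV i u : V i (take n u) -> n <= size u.
  by move=> [] /eqP; rewrite size_take; case: ltnP => [/ltnW//|_ /eqP <-].
have UV i u z : V i (take n u) -> mkseq z (size u) = u -> U i z.
  move=> Vu uz; apply: (Vu.2); rewrite -uz take_mkseq //.
  exact: sizeV Vu.
have word_point (x : X) u : exists z : seqs X, mkseq z (size u) = u.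
  exists (nth x u); exact: mkseq_nth.
exists n, V, E, (\bigcup_(i in [set: 'I_d.+1]) F i); split.
- move=> w wn.
  have [x _] : exists x : X, True by case: w wn => // x w _; exists x.
  have [z zw] := word_point x w; have [i iP] := DP z.
  exists i; split=> // y yw; apply: iP; apply: (@lword_le _ _ _ _ _ _ n) => //.
  by apply/lword_mkseq; rewrite yw -zw wn.
- by apply: bigcup_finite => // i _; exact: (FP i).1.
- move=> i u v Vu Vv [g Ng gu]; split=> //; exists g => // z uz.
  have [_ _] := HP i; apply; split; first by exists g => //; exists z.
  change (U i (germ_src (germ_pi (g, z))) /\ U i (germ_rng (germ_pi (g, z)))).
  rewrite germ_srcE germ_rngE /=; split; first exact: UV Vu uz.
  by apply: UV Vv _; rewrite -gu size_wact mkseq_oact uz.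
- move=> i u v [Vu Vv [g gu gP]]; split=> //; first split=> //.
    exists g^-1%g => [|z vz]; first by rewrite -gu -wactM mulVg wact1.
    have [[invH _] _ _] := HP i.
    have zE : oact g (oact g^-1%g z) = z by rewrite -oactM mulgV oact1.
    have := invH (germ_pi (g, oact g^-1%g z)); rewrite /= germ_invE /= zE; apply.
    apply: gP; rewrite mkseq_oact.
    by rewrite -{2}(wact1 u) -(mulVg g) wactM gu -(size_wact g) gu vz.
  have [x _] : exists x : X, True.
    by have := sizeV _ _ Vu; case: (u) => // x w _; exists x.
  have [z uz] := word_point x u.
  have [f Ff [y _ /germ_piP /= [yz /nbhs_singleton fg]]] := (FP i).2 _ (gP z uz).
  exists f; first by exists i.
  by rewrite -gu -uz -!mkseq_oact -yz fg.
- move=> i u v w [Vu Vv [g gu gP]] [_ Vw [h hv hP]]; split=> //.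
  exists (h * g)%g => [|z uz]; first by rewrite wactM gu.
  have [[_ mulH] _ _] := HP i.
  have := mulH (germ_pi (h, oact g z)) (germ_pi (g, z)).
  rewrite /= germ_mulE //= germ_srcE germ_rngE; apply=> //; last exact: gP.
  by apply: hP; rewrite mkseq_oact -gu size_wact uz.
Qed.

(** Each of the finitely many isomorphisms in the groupoid of one colour has a
    compact set of germs on the boundary, and these germs form a subgroupoid. *)
Lemma tree_condition_dyn_asdim :
  (forall A : set G, finite_set A -> tree_condition X d A) ->
  dyn_asdim_le (germ_groupoid X) d.
Proof.
move=> treeA C /compact_germs[A [finA CA]].
have [n [V [n_gt0 covV _ finV]]] := treeA A finA.
pose Gen (i : 'I_d.+1) := generated_groupoid (tree_generators A (V i)).
exists (fun i => [set z | V i (mkseq z n)]); split.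
- move=> i; apply/open_cylinder => z Vz; exists n => y /lword_mkseq yz.
  by rewrite /= yz.
- apply/seteqP; split=> // z _.
  have : [set w : seq X | size w = n] (mkseq z n) by rewrite /= size_mkseq.
  by rewrite -covV => -[i _ Vz]; exists i.
move=> i; pose K f := [set germ_pi (subtree_rep f, z) |
  z in [set z | f = subtree_map (subtree_rep f) (mkseq z n)]].
have GenK g z : Gen i (subtree_map g (mkseq z n)) ->
    (\bigcup_(f in Gen i) K f) (germ_pi (g, z)).
  move=> Gg; exists (subtree_map g (mkseq z n)) => //.
  exists z; first by rewrite /= subtree_repE.
  apply/germ_piP; split=> //=; apply: filterS (nbhs_prefix z n) => y yz.
  apply: mkseq_ext; exists n => m nm; rewrite !mkseq_oact.
  by apply: subtree_rep_wact; rewrite -yz; exact: mkseq_prefix.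
have KGen a : (\bigcup_(f in Gen i) K f) a -> exists g z,
    a = germ_pi (g, z) /\ Gen i (subtree_map g (mkseq z n)).
  by move=> [f Gf [z /= fE <-]]; exists (subtree_rep f), z; rewrite -fE.
exists (\bigcup_(f in Gen i) K f); split.
- split=> [_ /KGen[g [z [-> Gg]]]|_ _ /KGen[g [z [-> Gg]]] /KGen[h [y [-> Gh]]]] /=.
    rewrite germ_invE; apply: GenK; rewrite mkseq_oact.
    exact: generated_subtreeV.
  rewrite germ_srcE germ_rngE /= => zy; rewrite germ_mulE //=; apply: GenK.
  by apply: generated_subtreeM Gh; rewrite -mkseq_oact -zy.
- apply: finite_bigcup_compact => [|f _]; first exact: finV.
  apply: (continuous_compact (f := fun z => germ_pi (subtree_rep f, z))).
    exact/continuous_subspaceT/germ_pi_section_continuous.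
  apply: (subclosed_compact _ (@seqs_compact _ _ X)) => //.
  rewrite -openC; apply/open_cylinder => z nfz; exists n => y /lword_mkseq yz.
  by rewrite /= yz.
- move=> a [Ca [Vs Vr]]; have [g Ag [z _ za]] := CA a Ca.
  move: Vs Vr; rewrite /= -za germ_srcE germ_rngE /= => Vz Vgz.
  apply: GenK; apply: sub_gen_smallest; exists g, (mkseq z n); split=> //.
  by rewrite -mkseq_oact.
Qed.

End Germs.

(** * Local charts of the limit space *)

Section Charts.
Variables (G : groupType) (B : biset G) (X : biset_basis B).
Implicit Types (g h : G) (u v w : seq X) (y z : seqs X) (F : set G).
Hypothesis contr : exists N : set G, finite_set N /\ absorbing X N.
Local Notation N := (nucleus X).

Definition isotropy F y n : set G :=
  [set g | exists t, [/\ F t, wact t (lword y n) = lword y n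
                      & g = sect t (lword y n)]].

(** The isotropy group of [y] in the limit orbispace. *)
Definition asymp_isotropy y : set G := \bigcap_n isotropy N y n.

Lemma isotropy_le F y m n : sect_closed X F ->
  m <= n -> isotropy F y n `<=` isotropy F y m.
Proof.
move=> scF mn _ [t [Ft ty ->]].
exists (sect t (take (size (lword y n) - m) (lword y n))); split.
- exact: scF.
- by rewrite -(suf_lword y mn) -wact_suf ty.
- by rewrite -(suf_lword y mn) -sect_suf.
Qed.

Lemma isotropy_contract F : finite_set F -> exists k, forall y n,
  isotropy F y (n + k) `<=` isotropy N y n.
Proof.
move=> finF; have [k kP] := nucleus_absorbing_finite contr finF.
exists k => y n _ [t [Ft ty ->]]; have nk := leq_addr k n.
exists (sect t (take (size (lword y (n + k)) - n) (lword y (n + k)))); split.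
- by apply: kP => //; rewrite size_takel ?leq_subr // size_lword addKn.
- by rewrite -(suf_lword y nk) -wact_suf ty.
- by rewrite -(suf_lword y nk) -sect_suf.
Qed.

Lemma decreasing_finite_stable (T : eqType) (P : nat -> set T) :
  finite_set (P 0) -> (forall m n, m <= n -> P n `<=` P m) ->
  exists n, P n `<=` \bigcap_m P m.
Proof.
move=> /finite_seqP[s P0] decP.
suff [n nP] : exists n, forall x, x \in s -> P n x -> forall m, P m x.
  exists n => x Pnx m _; apply: nP => //.
  have : P 0 x by exact: decP Pnx.
  by rewrite P0.
elim: s {P0} => [|a s [n nP]]; first by exists 0.
have [Pa|/existsNP[m nPa]] := pselect (forall m, P m a).
  by exists n => x; rewrite inE => /predU1P[->|/nP].
exists (maxn n m) => x; rewrite inE => /predU1P[->|xs Px].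
  by move=> /(decP _ _ (leq_maxr n m)).
by apply: nP => //; exact: decP (leq_maxl n m) _ Px.
Qed.

Lemma isotropy_stable y :
  exists n, isotropy (prods N 3) y n `<=` asymp_isotropy y.
Proof.
have finN := nucleus_finite contr.
have [n nP] : exists n, isotropy N y n `<=` asymp_isotropy y.
  apply: decreasing_finite_stable => [|m n].
    by apply: sub_finite_set finN => _ [t [Nt _ ->]].
  exact: isotropy_le (nucleus_sect contr).
have [k kP] := isotropy_contract (prods_finite 3 finN).
by exists (n + k) => g /kP/nP.
Qed.

Lemma asymp_isotropyV y g : asymp_isotropy y g -> asymp_isotropy y g^-1%g.
Proof.
move=> yg n _; have [t [Nt ty ->]] := yg n Logic.I.
have tVy : wact t^-1%g (lword y n) = lword y n.
  by rewrite -{1}ty -wactM mulVg wact1.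
by exists t^-1%g; split=> //; [exact: nucleusV | rewrite sectV tVy].
Qed.

Lemma asymp_isotropyM y g h : asymp_isotropy y g -> asymp_isotropy y h ->
  asymp_isotropy y (g * h)%g.
Proof.
move=> yg yh n _; have [k kP] :=
  isotropy_contract (prods_finite 2 (nucleus_finite contr)).
have [s [Ns sy ->]] := yg (n + k) Logic.I.
have [t [Nt ty ->]] := yh (n + k) Logic.I.
apply: kP; exists (s * t)%g; split; first exact: (prodsM (prods1 Ns) (prods1 Nt)).
  by rewrite wactM ty.
by rewrite sectM ty.
Qed.

(** A finite groupoid that controls all paths in [O]: by composition, [Γ u v]
    contains the section at [u] of every nonempty product of elements of the
    nucleus that takes [u] to [v] through words whose tiles meet [O]. *)
Definition chart (O : set (seqs X)) n (Γ : seq X -> seq X -> set G) : Prop :=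
  [/\ forall u v h, Γ u v h -> Γ v u h^-1%g,
      forall u v w g h, Γ u v g -> Γ v w h -> Γ u w (h * g)%g,
      forall s y z, N s -> O y -> O z -> wact s (lword y n) = lword z n ->
        Γ (lword y n) (lword z n) (sect s (lword y n))
    & finite_set [set h | exists u v, Γ u v h]].

(** Close to [y], a word of length [n] is the image of the word of [y] under
    some [a] in the nucleus, and a move is recorded by its difference to such
    choices, which for large [n] is in the finite isotropy group of [y]: paths
    have no monodromy outside of this group. *)
Lemma exists_chart y : exists O, [/\ open O, saturated O, O y
  & exists n Γ, chart O n Γ].
Proof.
have [n nP] := isotropy_stable y; set yn := lword y n.
have N1 : N 1%g by exact: (nucleus1 (y 0)).
have N3 : prods N 2 `<=` prods N 3 by exact: prods_le.
exists (sat_interior [set z | moves N yn (lword z n)]); split.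
- exact: sat_interior_open.
- exact: sat_interior_saturated.
- by exists n.
have sectVM a b v : wact a yn = v -> wact b yn = v ->
    sect (a^-1 * b)%g yn = ((sect a yn)^-1 * sect b yn)%g.
  by move=> av bv; rewrite sectM sectV bv -av -wactM mulVg wact1.
exists n, (fun u v => [set h | exists a b p, [/\ N a, N b, asymp_isotropy y p,
  wact a yn = u & wact b yn = v /\
  h = (sect b yn * p * (sect a yn)^-1)%g]]); split.
- move=> u v _ [a [b [p [Na Nb yp au [bv ->]]]]].
  exists b, a, p^-1%g; split=> //; first exact: asymp_isotropyV.
  by split=> //; rewrite !invgM invgK mulgA.
- move=> u v w g h [a [b [p [Na Nb yp au [bv ->]]]]].
  move=> [a' [b' [p' [Na' Nb' yp' a'v [b'w ->]]]]].
  exists a, b', (p' * sect (a'^-1 * b)%g yn * p)%g; split=> //.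
    apply: asymp_isotropyM => //; apply: asymp_isotropyM => //; apply: nP.
    exists (a'^-1 * b)%g; split=> //.
      apply/N3/(prodsM (j := 1) (k := 1)); last exact: prods1.
      by apply: prods1; exact: nucleusV.
    by rewrite wactM bv -a'v -wactM mulVg wact1.
  by split=> //; rewrite (sectVM _ _ _ a'v bv) !mulgA.
- move=> s z z' Ns /sat_interior_sub[a Na az] /sat_interior_sub[b Nb bz'] sz.
  have bsa : wact (b^-1 * (s * a))%g yn = yn.
    by rewrite !wactM az sz -bz' -wactM mulVg wact1.
  exists a, b, (sect (b^-1 * (s * a))%g yn); split=> //.
    apply: nP; exists (b^-1 * (s * a))%g; split=> //.
    apply: (prodsM (j := 1) (k := 2)); first by apply: prods1; exact: nucleusV.
    by apply: (prodsM (j := 1) (k := 1)); exact: prods1.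
  split=> //; rewrite (sectVM _ _ (lword z' n)) //; last by rewrite wactM az.
  by rewrite sectM az !mulgA mulgV mul1g mulgK.
- have finN := nucleus_finite contr.
  have finI : finite_set (asymp_isotropy y).
    by apply: sub_finite_set finN => g /(_ 0 Logic.I) [t [Nt _ ->]].
  apply: sub_finite_set (finite_image2 (fun b q => b * q^-1)%g
    (finite_image2 (fun b p => b * p)%g finN finI) finN).
  move=> _ [u [v [a [b [p [Na Nb yp _ [_ ->]]]]]]].
  exists (sect b yn * p)%g.
    by exists (sect b yn); [exact: nucleus_sect | exists p].
  by exists (sect a yn) => //; exact: nucleus_sect.
Qed.

End Charts.

(** * From coverings of the limit space to colourings of the tree *)

Lemma count_card_le (T : choiceType) (s : seq T) (P : set T) n : uniq s ->
  ([set x | x \in s /\ P x] #<= `I_n)%card -> count (fun x => `[< P x >]) s <= n.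
Proof.
move=> us /pcard_leP[f]; rewrite -size_filter -(size_iota 0 n).
set r := seq.filter _ s; rewrite -(size_map f r).
have rP x : x \in r -> x \in s /\ P x by rewrite mem_filter => /andP[/asboolP].
apply: uniq_leq_size.
  rewrite map_inj_in_uniq ?filter_uniq // => x y /rP xr /rP yr.
  by apply: (@inj _ _ _ f); apply/mem_set.
move=> _ /mapP[x /rP xr ->]; rewrite mem_iota /=.
exact: (@funS _ _ _ _ f).
Qed.

Lemma sub_count_lt (T : eqType) (P Q : pred T) (s : seq T) x :
    {in s, forall y, P y -> Q y} -> x \in s -> Q x -> ~~ P x ->
  count P s < count Q s.
Proof.
move=> PQ xs Qx nPx; rewrite !(permP (perm_to_rem xs)) /= Qx (negbTE nPx) ltnS.
rewrite (@eq_in_count _ P (predI P Q)) => [|y /mem_rem ys /=].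
  by apply: sub_count => y /andP[].
by case Py: (P y); rewrite //= PQ.
Qed.

Section Colouring.
Variables (G : groupType) (B : biset G) (X : biset_basis B) (d : nat).
Implicit Types (g h : G) (u v w : seq X) (y z : seqs X) (F : set G).
Hypothesis contr : exists N : set G, finite_set N /\ absorbing X N.
Local Notation N := (nucleus X).
Local Notation limit_pi := (@limit_pi G B X).

Lemma chart_sub (O Q : set (seqs X)) n Γ : Q `<=` O ->
  chart O n Γ -> chart Q n Γ.
Proof.
move=> QO [GV GM GN finG]; split=> // t y z Nt /QO Oy /QO Oz; exact: GN.
Qed.

(** By compactness, finitely many charts cover the limit space, and the
    covering dimension bounds the multiplicity of a refinement. *)
Lemma covering_by_charts : covering_dim_le (limit_space X) d ->
  exists s : seq (set (limit_space X)),
  [/\ forall j, j \in s -> open j, forall a, exists2 j, j \in s & j a,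
      forall a, count (fun j : set _ => `[< j a >]) s <= d.+1
    & forall j, j \in s -> exists n Γ, chart (limit_pi @^-1` j) n Γ].
Proof.
move=> dimX; have /choice[O OP] := exists_chart contr.
have oO y : open (O y) by have [] := OP y.
have [D DP] : exists D, forall z, exists y, forall x,
    lword x D = lword z D -> O y x.
  by apply: cylinder_cover => // z; exists z; have [] := OP z.
have /choice[c cP] : forall w : seq X, exists Q : set (seqs X),
    [/\ open Q, saturated Q, exists n Γ, chart Q n Γ
      & forall z, lword z D = w -> Q z].
  move=> w; have [[z zw]|noz] := pselect (exists z : seqs X, lword z D = w).
    have [y yP] := DP z; exists (O y); have [oOy sOy _ chOy] := OP y.
    by split=> // x xw; apply: yP; rewrite xw.
  exists set0; split=> //; first exact: open0.
    exists 0, (fun _ _ => set0); split=> //.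
    by apply: sub_finite_set (finite_set0 G) => h [u [v []]].
  by move=> z zw; case: noz; exists z.
have [|||V [finV oV covV VU cardV]] :=
    dimX [set limit_pi @` c w | w in [set w | size w = D]].
- exact/finite_image/finite_words.
- move=> _ [w _ <-]; have [oc sc _ _] := cP w.
  by rewrite -limit_pi_open preimage_limit_pi.
- apply/seteqP; split=> // a _; have [z <-] := limit_pi_surj a.
  exists (limit_pi @` c (lword z D)); last first.
    by exists z => //; have [_ _ _] := cP (lword z D); apply.
  by exists (lword z D) => //; rewrite /= size_lword.
have [s0 sV] := (finite_seqP V).1 finV; pose s := undup s0.
have Vs j : (j \in s) = (j \in s0) by rewrite mem_undup.
exists s; split.
- by move=> j; rewrite Vs => js; apply: oV; rewrite sV.
- move=> a; have : [set: limit_space X] a by [].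
  by rewrite -covV => -[j Vj ja]; exists j => //; rewrite Vs; rewrite sV in Vj.
- move=> a; apply: (@count_card_le _ _ (fun j => j a)); first exact: undup_uniq.
  apply: card_le_trans (cardV a); apply: subset_card_le => j [js ja].
  by split=> //; rewrite sV /= -Vs.
- move=> j; rewrite Vs => js.
  have [|_ [w _ <-] jc] := VU j; first by rewrite sV.
  have [_ sc [n [Γ ch]] _] := cP w; exists n, Γ; apply: chart_sub ch.
  by move=> z /jc; rewrite -[X in _ -> X z](preimage_limit_pi contr sc).
Qed.

(** The points [z] form a neighbourhood of the tile of [u] that shrinks as [t]
    grows. *)
Definition inside t (j : set (limit_space X)) u : Prop :=
  forall z, moves N (suf t u) (lword z t) -> j (limit_pi z).

Lemma inside_le t t' j u : t <= t' <= size u -> inside t j u -> inside t' j u.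
Proof.
move=> /[dup] tt'u /andP[tt' t'u] jt z /(moves_nucleus_suf contr t).
by rewrite suf_suf // suf_lword //; exact: jt.
Qed.

Lemma inside_moves : exists k, forall t j u v, t + k <= size u ->
  moves N u v -> inside t j u -> inside (t + k) j v.
Proof.
have [k kP] := moves_contract contr (prods_finite 2 (nucleus_finite contr)).
exists k => t j u v tku uv jt z vz; apply: jt; have tk := leq_addr k t.
rewrite -(suf_suf (s := t) (t := t + k)) ?tk // -(suf_lword z tk).
apply: kP; first by rewrite size_suf.
have [g Ng gE] := moves_nucleus_suf contr (t + k) uv; have [h Nh hE] := vz.
apply: (@moves_prods _ _ _ _ 1 1 _ (suf (t + k) v)).
  by exists g => //; exact: prods1.
by exists h => //; exact: prods1.
Qed.

Lemma inside_lword t j z m : t <= m -> inside t j (lword z m) -> j (limit_pi z).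
Proof.
move=> tm; apply; rewrite suf_lword //.
by exists 1%g; [exact: (nucleus1 (z 0)) | exact: wact1].
Qed.

Lemma word_lword u : 0 < size u -> exists z, lword z (size u) = u.
Proof. by case: u => // x u _; exact: (lword_extend (fun=> x)). Qed.

Variable s : seq (set (limit_space X)).

Lemma inside_cover :
    (forall j, j \in s -> open j) -> (forall a, exists2 j, j \in s & j a) ->
  exists D, forall u, D <= size u -> 0 < size u ->
    exists2 j, j \in s & inside D j u.
Proof.
move=> os cs; pose O (j : set _) := [set z | j \in s /\ j (limit_pi z)].
have [D DP] : exists D, forall l, D <= l -> forall z, exists j, forall y,
    moves N (lword z l) (lword y l) -> O j y.
  apply: (saturated_cover contr (nucleus_finite contr)).
  - move=> j; have [js|njs] := boolP (j \in s); last first.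
      rewrite (_ : O j = set0); first exact: open0.
      by apply/seteqP; split=> // z []; rewrite (negbTE njs).
    rewrite (_ : O j = limit_pi @^-1` j); first exact: os.
    by apply/seteqP; split=> [z []|z].
  - by move=> j y z /(limit_piP contr) yz [js jy]; split=> //; rewrite -yz.
  - by move=> z; have [j js jz] := cs (limit_pi z); exists j.
exists D => u Du /word_lword[z zu]; have [j jP] := DP D (leqnn D) z.
exists j; last by move=> y; rewrite -zu suf_lword ?zu // => /jP[].
have [] // := jP z; exists 1%g; [exact: (nucleus1 (z 0)) | exact: wact1].
Qed.

(** The number of sets [j] with [inside (D + i * k) j u] is nondecreasing in [i],
    from at least one to at most [d + 1], so it cannot grow at each
    of the [d + 1] steps. *)
Lemma colour_exists D k u :
    (forall a, count (fun j : set _ => `[< j a >]) s <= d.+1) ->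
    D + d.+1 * k <= size u -> 0 < size u -> (exists2 j, j \in s & inside D j u) ->
  exists i : 'I_d.+1, forall j, j \in s ->
    inside (D + i.+1 * k) j u -> inside (D + i * k) j u.
Proof.
move=> cs Du u_gt0 [j0 j0s j0D]; apply: contrapT => /forallNP no.
pose c i := count (fun j => `[< inside (D + i * k) j u >]) s.
suff lt_c i : i <= d.+1 -> i < c i.
  have [z zu] := word_lword u_gt0.
  have := leq_trans (lt_c _ (leqnn _)) (leq_trans _ (cs (limit_pi z))).
  rewrite ltnn => /(_ _)/notF; apply.
  apply: sub_count => j /asboolP jz.
  by apply/asboolP; apply: (@inside_lword (D + d.+1 * k) j z (size u)); rewrite ?zu.
elim: i => [|i IHi] id.
  by rewrite -has_count; apply/hasP; exists j0 => //; apply/asboolP; rewrite addn0.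
apply: leq_ltn_trans (IHi (ltnW id)) _.
have /existsNP[j /not_implyP[js /not_implyP[jS nj]]] := no (Ordinal id).
apply: (@sub_count_lt _ _ _ _ j) => //=; [|exact/asboolP|exact/asboolPn].
move=> l ls /asboolP il; apply/asboolP; apply: inside_le il.
rewrite leq_add2l leq_mul2r leqnSn orbT /= (leq_trans _ Du) //.
by rewrite leq_add2l leq_mul2r id orbT.
Qed.

End Colouring.

(** * Finiteness of the groupoids of a colouring *)

Section TreeCondition.
Variables (G : groupType) (B : biset G) (X : biset_basis B) (d : nat).
Implicit Types (g h : G) (u v w : seq X) (y z : seqs X) (F : set G).
Local Notation N := (nucleus X).

(** The isomorphism [v X^* -> v' X^*] acting by [h] below [v]. *)
Definition transport v v' h : set (seq X * seq X) :=
  [set (v ++ w, v' ++ wact h w) | w in [set: seq X]].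

Lemma subtree_map_transport g v :
  subtree_map g v = transport v (wact g v) (sect g v).
Proof.
apply/seteqP; split=> [_ [_ /prefixP[w ->] <-]|_ [w _ <-]].
  by exists w; rewrite // wact_cat.
by exists (v ++ w); [exact: prefix_prefix | rewrite wact_cat].
Qed.

Lemma fst_transport v v' h : fst @` transport v v' h = [set w | prefix v w].
Proof.
apply/seteqP; split=> [_ [_ [w _ <-] <-]|_ /prefixP[w ->]] /=.
  exact: prefix_prefix.
by exists (v ++ w, v' ++ wact h w) => //; exists w.
Qed.

Lemma transport_inv v v' h :
  ((transport v v' h)^-1)%relation = transport v' v h^-1%g.
Proof.
apply/seteqP; split=> -[a b] [w _ [<- <-]] /=.
  by exists (wact h w); rewrite // -wactM mulVg wact1.
by exists (wact h^-1%g w); rewrite // -wactM mulgV wact1.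
Qed.

Lemma snd_transport v v' h : snd @` transport v v' h = [set w | prefix v' w].
Proof.
rewrite -(fst_transport v' v h^-1%g) -transport_inv.
by apply/seteqP; split=> w [[a b] ab <-]; exists (b, a).
Qed.

Lemma transport_comp u v w g h :
  (transport v w h \; transport u v g)%relation = transport u w (h * g)%g.
Proof.
apply/seteqP; split=> -[a b] /=.
  move=> [c [r _ [<- <-]] [r' _ [/eqP + <-]]].
  by rewrite eqseq_cat // eqxx => /eqP ->; exists r; rewrite // wactM.
move=> [r _ [<- <-]]; exists (v ++ wact g r); first by exists r.
by exists (wact g r); rewrite // wactM.
Qed.

Lemma finite_generated_transport (S : set (set (seq X * seq X)))
    (R : seq X -> seq X -> set G) (W : set (seq X)) (K : set G) :
    finite_set W -> finite_set K ->
    (forall u v h, R u v h -> [/\ W u, W v, K h & R v u h^-1%g]) ->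
    (forall u v w g h, R u v g -> R v w h -> R u w (h * g)%g) ->
    (forall f, S f -> exists u v h, R u v h /\ f = transport u v h) ->
  finite_set (generated_groupoid S).
Proof.
move=> finW finK RP RM SR.
pose H := [set f | exists u v h, R u v h /\ f = transport u v h].
suff : generated_groupoid S `<=` H.
  move/sub_finite_set; apply.
  apply: sub_finite_set (finite_image (fun p => transport p.1.1 p.1.2 p.2)
    (finite_setX (finite_setX finW finW) finK)).
  move=> _ [u [v [h [/RP[Wu Wv Kh _] ->]]]].
  by exists (u, v, h).
apply: smallest_sub => //; split.
  move=> _ [u [v [h [Rh ->]]]]; rewrite transport_inv.
  by exists v, u, h^-1%g; have [_ _ _] := RP _ _ _ Rh.
move=> _ _ [u [v [h [Rh ->]]]] [u' [v' [h' [Rh' ->]]]].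
rewrite fst_transport snd_transport => /prefix_set_inj E.
rewrite -E in Rh' *; rewrite transport_comp; exists u', v, (h * h')%g.
by split=> //; exact: RM Rh' Rh.
Qed.

Hypothesis contr : exists N : set G, finite_set N /\ absorbing X N.
Local Notation limit_pi := (@limit_pi G B X).

(** Adjacent words of one colour lie in the same sets of the cover, so that
    paths inside a colour are controlled by the chart of a single such set. *)
Lemma covering_dim_tree_condition : covering_dim_le (limit_space X) d ->
  forall A : set G, finite_set A -> tree_condition X d A.
Proof.
move=> /(covering_by_charts contr)[s [os cs ms charts]] A finA.
have /choice[p pP] : forall j : set (limit_space X),
    exists p : nat * (seq X -> seq X -> set G),
    j \in s -> chart (limit_pi @^-1` j) p.1 p.2.
  move=> j; have [js|njs] := boolP (j \in s); last by exists (0, fun _ _ => set0).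
  by have [n [Γ ch]] := charts j js; exists (n, Γ).
have [k kP] := inside_moves contr.
have [l lP] := nucleus_absorbing_finite contr finA.
have [D DP] := inside_cover contr os cs.
(* A word has [l] letters for [A] to contract to the nucleus, and [m] further
   letters, enough for all the lengths [t i] and for all the charts. *)
pose t i := D + i * k; pose M := \max_(j <- s) (p j).1.
pose m := t d.+1 + M; pose n := (l + m).+1.
have pM j : j \in s -> (p j).1 <= M.
  by move=> js; rewrite /M (big_rem j) //= leq_maxl.
have mn : m <= n by rewrite /n ltnW // ltnS leq_addl.
have tm i : i <= d.+1 -> t i <= m.
  move=> id; apply: leq_trans (leq_addr M _).
  by rewrite leq_add2l leq_mul2r id orbT.
have Dn : D <= n by apply: leq_trans mn; rewrite /m /t -addnA leq_addr.
pose good v (i : 'I_d.+1) := forall j, j \in s ->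
  inside (t i.+1) j v -> inside (t i) j v.
have goodP v : size v = n -> exists i, good v i.
  move=> vn; apply: (colour_exists contr ms); rewrite ?vn //.
    exact: leq_trans (tm _ (leqnn _)) mn.
  by apply: DP; rewrite vn.
pose col v : 'I_d.+1 := xget ord0 [set i | good v i].
have colP v : size v = n -> good v (col v).
  by move=> /goodP; exact: xgetPex.
exists n, (fun i => [set v | size v = n /\ col v = i]); split=> //.
- by apply/seteqP; split=> [v [i _ []] //|v vn]; exists (col v).
- by move=> i j _ _ [v [[_ <-] [_ <-]]].
move=> i.
pose R u v : set G := [set h | [/\ size u = n /\ col u = i, size v = n /\ col v = i,
  forall j, j \in s -> inside (t i) j u <-> inside (t i) j v
  & forall j, j \in s -> inside (t i) j u ->
      (p j).2 (suf (p j).1 u) (suf (p j).1 v) h]].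
pose K := \bigcup_(j in [set` s]) [set h | exists u v, (p j).2 u v h].
apply: (@finite_generated_transport _ R [set v | size v = n] K).
- exact: finite_words.
- apply: bigcup_finite => [|j js]; first exact: finite_seq.
  by have [] := pP j js.
- move=> u v h [[un ui] [vn vi] uv Rh]; split=> //.
    have [||j js jD] := DP u; rewrite ?un //.
    exists j => //; exists (suf (p j).1 u), (suf (p j).1 v); apply: Rh => //.
    apply: (inside_le contr _ jD); rewrite un.
    by rewrite leq_addr (leq_trans (tm i (ltnW (ltn_ord i)))).
  split=> // j js; first by split=> /uv; apply.
  by move=> /(uv j js) ju; have [GV _ _ _] := pP j js; apply: GV; exact: Rh.
- move=> u v w g h [ui _ uv Rg] [_ wi vw Rh]; split=> //.
    by move=> j js; split=> [/(uv j js)/(vw j js)|/(vw j js)/(uv j js)].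
  move=> j js ju; have [_ GM _ _] := pP j js.
  by apply: GM (Rg j js ju) (Rh j js _); exact/(uv j js).
move=> f [g [v [Ag [vn vi] [gvn gvi] ->]]].
exists v, (wact g v), (sect g v); rewrite subtree_map_transport; split=> //.
have sN r : r <= m -> N (sect g (take (size v - r) v)).
  move=> rm; apply: lP => //; rewrite size_takel ?leq_subr // vn.
  by rewrite leq_subRL ?(leq_trans rm mn) // addnC /n -addnS leq_add // ltnW.
have adj r : r <= m -> moves N (suf r v) (suf r (wact g v)).
  move=> rm; rewrite wact_suf.
  by exists (sect g (take (size v - r) v)) => //; exact: sN.
have inside_suf r j u : size u = n -> r <= m ->
    inside r j (suf m u) <-> inside r j u.
  by move=> un rm; rewrite /inside suf_suf // rm un.
have go u v' j : j \in s -> size u = n -> size v' = n -> col v' = i ->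
    moves N (suf m u) (suf m v') -> inside (t i) j u -> inside (t i) j v'.
  move=> js un v'n v'i uv' ju; have := colP v' v'n; rewrite v'i => /(_ j js); apply.
  have tS : t i.+1 = t i + k by rewrite /t mulSn addnCA addnC.
  apply/inside_suf; rewrite ?tm ?ltn_ord // tS; apply: kP uv' _.
    by rewrite size_suf ?un // -tS tm.
  by apply/inside_suf; rewrite ?tm // ltnW.
have gv_iff j : j \in s -> inside (t i) j v <-> inside (t i) j (wact g v).
  move=> js; have mv := adj m (leqnn m).
  by split; apply: go => //; exact: moves_nucleusV.
split=> // j js jv; set q := (p j).1.
have qm : q <= m by rewrite (leq_trans (pM j js)) // leq_addl.
have tn : t i <= n by rewrite (leq_trans _ mn) // tm // ltnW.
have [x xv] : exists x, lword x n = v by rewrite -vn; apply: word_lword; rewrite vn.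
have [x' xv'] : exists x, lword x n = wact g v.
  by rewrite -gvn; apply: word_lword; rewrite gvn.
have xj : j (limit_pi x) by apply: (inside_lword (m := n) tn); rewrite xv.
have xj' : j (limit_pi x').
  by apply: (inside_lword (m := n) tn); rewrite xv'; exact/gv_iff.
have [_ _ Gstep _] := pP j js.
have xE y u : lword y n = u -> lword y q = suf q u.
  by move=> <-; rewrite suf_lword // (leq_trans qm mn).
have := Gstep (sect g (take (size v - q) v)) x x' (sN q qm) xj xj'.
by rewrite -/q (xE _ _ xv) (xE _ _ xv') -wact_suf -sect_suf; apply.
Qed.

End TreeCondition.

(** * The equivalence *)

Theorem theorem3p4 (G : groupType) (B : biset G) (X : biset_basis B) (d : nat) :
  contracting B ->
  [<-> covering_dim_le (limit_space X) d;
       forall A : set G, finite_set A -> tree_condition X d A;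
       tree_condition X d (nucleus X);
       dyn_asdim_le (germ_groupoid X) d].
Proof.
move=> /(contracting_basis X) contr.
have dim_of_bounded := @bounded_components_covering_dim _ _ X d contr.
have tree_of_dim := @covering_dim_tree_condition _ _ X d contr.
tfae.
- exact: tree_of_dim.
- by apply; exact: nucleus_finite.
- move=> /(tree_condition_bounded_components contr)/dim_of_bounded/tree_of_dim.
  exact: tree_condition_dyn_asdim.
- by move=> /(dyn_asdim_bounded_components contr)/dim_of_bounded.
Qed.
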